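(* Let $\mathbf{x}^\ast\in\mathcal{X}_0$ satisfy $\tilde{\mathbf{g}}(\mathbf{x}^\ast)\le\mathbf{0}$, e.g., $\mathbf{x}^\ast=\operatorname{argmin}_{\mathbf{x}\in\mathcal{X}}\sum_{t=1}^T f^t(\mathbf{x})$, where $\mathcal{X}=\{\mathbf{x}\in\mathcal{X}_0:\tilde g_k(\mathbf{x})\le0,\ \forall k\in\{1,2,\ldots,m\}\}$. Let $0<\lambda<1$ be arbitrary. If $V=\sqrt{T}$ and $\alpha=T$ in Algorithm 1 (defined in the context), then for all $T\ge1$, we have $$\Pr\Big(\sum_{t=1}^{T} f^t(\mathbf{x}(t))\le\sum_{t=1}^{T} f^t(\mathbf{x}^\ast)+O\big(\sqrt{T}\log(T)\log^{1.5}(\tfrac1\lambda)\big)\Big)\ge1-\lambda .$$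
   Context: Setting. $\mathcal{X}_0\subset\mathbb{R}^n$ is a known fixed compact convex set. $\omega$ is a random variable with values in $\Omega$ and unknown distribution, and $\omega(1),\omega(2),\ldots$ are i.i.d. samples of $\omega$. For $k\in\{1,\ldots,m\}$, $g_k(\mathbf{x};\omega)$ is convex in $\mathbf{x}\in\mathcal{X}_0$ for each $\omega\in\Omega$. Write $g_k^t(\mathbf{x})=g_k(\mathbf{x};\omega(t))$, $\mathbf{g}(\mathbf{x};\omega)=[g_1(\mathbf{x};\omega),\ldots,g_m(\mathbf{x};\omega)]^{\mathsf T}$, $\mathbf{g}^t(\mathbf{x})=\mathbf{g}(\mathbf{x};\omega(t))$, $\tilde g_k(\mathbf{x})=\mathbb{E}_\omega[g_k(\mathbf{x};\omega)]$, $\tilde{\mathbf g}=[\tilde g_1,\ldots,\tilde g_m]^{\mathsf T}$; vector inequalities are componentwise. The loss functions $f^t$, $t=1,2,\ldots$, are convex on $\mathcal{X}_0$ and may vary arbitrarily, as long as each $f^t$ is independent of all $\omega(\tau)$ with $\tau\ge t+1$ (for example $f^t$ may be chosen adversarially based on $\omega(1),\ldots,\omega(t)$ and $\mathbf{x}(1),\ldots,\mathbf{x}(t)$). With $\mathcal{W}(0)=\{\emptyset,\Omega\}$ the trivial $\sigma$-algebra and $\mathcal{W}(t)=\sigma(\omega(1),\ldots,\omega(t))$, the quantities $\mathbf{x}(t)$ and $\mathbf{Q}(t)$ below are $\mathcal{W}(t-1)$-measurable for all $t\ge1$. $\|\cdot\|$ is the Euclidean norm. $\nabla h(\mathbf{x})$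 denotes a subgradient of the convex function $h$ at $\mathbf{x}$, i.e. $h(\mathbf{y})\ge h(\mathbf{x})+[\nabla h(\mathbf{x})]^{\mathsf T}[\mathbf{y}-\mathbf{x}]$ for all $\mathbf{y}\in\mathcal{X}_0$. Assumption (basic). There are constants $D_1,D_2,G,R>0$ such that $\|\nabla f^t(\mathbf{x})\|\le D_1$, $\|\nabla g_k(\mathbf{x};\omega)\|\le D_2$, $\|\mathbf{g}(\mathbf{x};\omega)\|\le G$ and $\|\mathbf{x}-\mathbf{y}\|\le R$ for all $\mathbf{x},\mathbf{y}\in\mathcal{X}_0$, all $t$, all $\omega\in\Omega$ and all $k$. Assumption (Slater). There are $\epsilon>0$ and $\hat{\mathbf{x}}\in\mathcal{X}_0$ with $\tilde g_k(\hat{\mathbf{x}})\le-\epsilon$ for all $k\in\{1,\ldots,m\}$. Algorithm 1. $V,\alpha$ are constant algorithm parameters. Choose $\mathbf{x}(1)\in\mathcal{X}_0$ arbitrarily and set $Q_k(1)=0$ for all $k$. At the end of each round $t\in\{1,2,\ldots\}$, observe $f^t,\mathbf{g}^t$ and: (i) let $\mathbf{x}(t+1)$ be the minimizer over $\mathbf{x}\in\mathcal{X}_0$ of $V[\nabla f^t(\mathbf{x}(t))]^{\mathsf T}[\mathbf{x}-\mathbf{x}(t)]+\sum_{k=1}^m Q_k(t)[\nabla g_k^t(\mathbf{x}(t))]^{\mathsf T}[\mathbf{x}-\mathbf{x}(t)]+\alpha\|\mathbf{x}-\mathbf{x}(t)\|^2$; (ii) set $Q_k(t+1)=\max\{Q_k(t)+g_k^t(\mathbf{x}(t))+[\nabla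 g_k^t(\mathbf{x}(t))]^{\mathsf T}[\mathbf{x}(t+1)-\mathbf{x}(t)],0\}$ for each $k$. Write $\mathbf{Q}(t)=[Q_1(t),\ldots,Q_m(t)]^{\mathsf T}$.
   Formalization: The factors log(T) and log(1/λ) in the O-bound are read as max(1, log T) and max(1, log(1/λ)), since the literal bound is false at T = 1 (log T = 0) and uniformly as λ tends to 1. *)

(* Defs.v *)
From HB Require Import structures.
From mathcomp Require Export all_boot all_order all_algebra finmap.
From mathcomp Require Export all_classical all_reals all_analysis.

Set Implicit Arguments.
Unset Strict Implicit.
Unset Printing Implicit Defensive.
Import Order.TTheory GRing.Theory Num.Theory.
Import numFieldNormedType.Exports.

Local Open Scope classical_set_scope.
Local Open Scope ring_scope.

Section euclidean.
Context {R : realType} {n : nat}.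
Implicit Types (u v x y : 'rV[R]_n) (A : set 'rV[R]_n) (h : 'rV[R]_n -> R).

Definition dot u v : R := \sum_i u ord0 i * v ord0 i.

(* The norm [`|u|] of the library on row vectors is the sup norm. *)
Definition enorm u : R := Num.sqrt (dot u u).

Definition is_subgradient A h x v := forall y, A y -> h x + dot v (y - x) <= h y.

Definition is_minimizer A h x := A x /\ forall y, A y -> h x <= h y.

End euclidean.

Section probability.
Context {d : measure_display} {S : measurableType d} {R : realType}.

(* The sigma-algebra generated by the variables [X i] for [i] in [D];
   it is trivial when [D] is empty. *)
Definition sigma_gen d' (U : measurableType d') (I : Type) (D : set I)
    (X : I -> S -> U) : set (set S) :=
  <<s \bigcup_(i in D) preimage_set_system setT (X i) measurable >>.

Definition measurable_wrt d' (U : measurableType d') (F : set (set S))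
    (X : S -> U) :=
  forall B, measurable B -> F (X @^-1` B).

Definition independent_systems (P : probability S R) (F H : set (set S)) :=
  forall A B, F A -> H B -> P (A `&` B) = (P A * P B)%E.

Definition mutually_independent d' (U : measurableType d') (P : probability S R)
    (D : set nat) (X : nat -> S -> U) :=
  forall (J : {fset nat}) (B : nat -> set U), [set` J] `<=` D ->
    (forall t, measurable (B t)) ->
    P (\bigcap_(t in [set` J]) X t @^-1` B t) =
    (\prod_(t <- J) P (X t @^-1` B t))%E.

End probability.

Section model.
Context {R : realType} {n m : nat}.
Context {dO : measure_display} {Omega : measurableType dO}.
Context {d : measure_display} {S : measurableType d}.

Record bounded_domain (X0 : set 'rV[R]_n) (Rad : R) : Prop := {
  domain_compact : compact X0 ;
  domain_convex : convex_set X0 ;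
  domain_diameter : forall x y, X0 x -> X0 y -> enorm (x - y) <= Rad }.

(* [gradg] is the selection of subgradients used by the algorithm. *)
Record constraint_functions (X0 : set 'rV[R]_n)
    (g : 'I_m -> 'rV[R]_n -> Omega -> R)
    (gradg : 'I_m -> 'rV[R]_n -> Omega -> 'rV[R]_n) (D2 G : R) : Prop := {
  constraint_measurable : forall k x, X0 x -> measurable_fun setT (g k x) ;
  constraint_convex : forall k o, convex_function X0 (fun x => g k x o) ;
  constraint_subgradient : forall k o x, X0 x ->
    is_subgradient X0 (fun y => g k y o) x (gradg k x o) ;
  constraint_subgradient_le : forall k o x, X0 x -> enorm (gradg k x o) <= D2 ;
  constraint_le : forall o x, X0 x -> enorm (\row_k g k x o) <= G }.

(* The samples are indexed from 1. *)
Record iid_samples (P : probability S R) (mu : probability Omega R)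
    (omega : nat -> {RV P >-> Omega}) : Prop := {
  samples_law : forall t, (1 <= t)%N -> forall A, measurable A ->
    distribution P (omega t) A = mu A ;
  samples_independent :
    mutually_independent P [set t | (1 <= t)%N] (fun t s => omega t s) }.

(* The losses are random functions: [f t s] is the function chosen at round
   [t >= 1] on the sample point [s], and [gradf t s] the selection of its
   subgradients used by the algorithm. *)
Record loss_functions (X0 : set 'rV[R]_n) (P : probability S R)
    (omega : nat -> {RV P >-> Omega}) (f : nat -> S -> 'rV[R]_n -> R)
    (gradf : nat -> S -> 'rV[R]_n -> 'rV[R]_n) (D1 : R) : Prop := {
  loss_measurable : forall t x, (1 <= t)%N -> X0 x ->
    measurable_fun setT (fun s => f t s x) ;
  loss_convex : forall t s, (1 <= t)%N -> convex_function X0 (f t s) ;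
  loss_subgradient : forall t s x, (1 <= t)%N -> X0 x ->
    is_subgradient X0 (f t s) x (gradf t s x) ;
  loss_subgradient_le : forall t s x, (1 <= t)%N -> X0 x ->
    enorm (gradf t s x) <= D1 ;
  loss_independent : forall t, (1 <= t)%N -> independent_systems P
    (sigma_gen X0 (fun x s => f t s x))
    (sigma_gen [set tau | (t < tau)%N] (fun tau s => omega tau s)) }.

Definition slater (X0 : set 'rV[R]_n) (mu : probability Omega R)
    (g : 'I_m -> 'rV[R]_n -> Omega -> R) (eps : R) :=
  exists2 xhat, X0 xhat & forall k, ('E_mu[g k xhat] <= (- eps)%:E)%E.

(* The decisions [x t] and the virtual queues [Q t] produced at the sample
   points [s] by the algorithm with parameters [V] and [alpha]. *)
Record algorithm1 (X0 : set 'rV[R]_n) (P : probability S R)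
    (g : 'I_m -> 'rV[R]_n -> Omega -> R)
    (gradg : 'I_m -> 'rV[R]_n -> Omega -> 'rV[R]_n)
    (omega : nat -> {RV P >-> Omega})
    (gradf : nat -> S -> 'rV[R]_n -> 'rV[R]_n) (V alpha : R)
    (x : nat -> S -> 'rV[R]_n) (Q : nat -> S -> 'I_m -> R) : Prop := {
  decision_init : forall s, X0 (x 1%N s) ;
  queue_init : forall s k, Q 1%N s k = 0 ;
  decision_step : forall t s, (1 <= t)%N ->
    is_minimizer X0 (fun y =>
      V * dot (gradf t s (x t s)) (y - x t s)
      + \sum_k Q t s k * dot (gradg k (x t s) (omega t s)) (y - x t s)
      + alpha * enorm (y - x t s) ^+ 2) (x t.+1 s) ;
  queue_step : forall t s k, (1 <= t)%N ->
    Q t.+1 s k =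
    Num.max (Q t s k + g k (x t s) (omega t s)
      + dot (gradg k (x t s) (omega t s)) (x t.+1 s - x t s)) 0 }.

Definition history (P : probability S R) (omega : nat -> {RV P >-> Omega})
    (t : nat) : set (set S) :=
  sigma_gen [set tau | (1 <= tau <= t)%N] (fun tau s => omega tau s).

(* Non-anticipation. As [history omega 0] is the trivial sigma-algebra, the
   initial decision does not depend on the sample point. *)
Record adapted_run (P : probability S R) (omega : nat -> {RV P >-> Omega})
    (x : nat -> S -> 'rV[R]_n) (Q : nat -> S -> 'I_m -> R) : Prop := {
  decision_adapted : forall t i, (1 <= t)%N ->
    measurable_wrt (history omega t.-1) (fun s => x t s ord0 i) ;
  queue_adapted : forall t k, (1 <= t)%N ->
    measurable_wrt (history omega t.-1) (fun s => Q t s k) }.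

End model.

(* Main.v *)
From HB Require Import structures.
Require Import Defs.
From mathcomp Require Import measurable_realfun ring lra.
Set Implicit Arguments.
Unset Strict Implicit.
Unset Printing Implicit Defensive.
Import Order.TTheory GRing.Theory Num.Theory.
Import numFieldNormedType.Exports.

Local Open Scope classical_set_scope.
Local Open Scope ring_scope.

(** Let y be a point of the domain. One round of the algorithm minimizes a
    linear function plus the quadratic T |z - x(t)|^2, and a minimizer of such
    an objective beats y by the margin T |y - x(t+1)|^2 ([proximal_step]).
    Adding the growth of the squared queues and the subgradient inequalities
    at y gives the estimate that drives the whole proof ([round_drift]):

      1/2 |Q(t+1)|^2 + T |y - x(t+1)|^2 + sqrt T (f^t(x(t)) - f^t(y))
        <= 1/2 |Q(t)|^2 + T |y - x(t)|^2 + Q(t).g^t(y) + B.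

    For y = xstar it telescopes: the regret is at most
    (Rad^2 + B) sqrt T + (sum_t Q(t).g^t(xstar)) / sqrt T
    ([regret_le_queued_constraints]). The sum has increments of nonpositive
    conditional mean, because Q(t) depends on the past only and omega(t) is
    fresh; as long as the queues stay below some q the increments are at most
    q G, and an estimate of Azuma type ([expR_weighted_sum_le]) bounds the sum
    by a multiple of q sqrt (T log (1/lambda)). To have bounded increments
    surely, the weights Q(t) are replaced by 0 when |Q(t)| > q; the truncated
    sum agrees with the original one when no queue ever exceeds q.

    To bound the queues, take for y the Slater point xhat. The potential
    Y(t) = sqrt (|Q(t)|^2 + 2 T |xhat - x(t)|^2) dominates |Q(t)|, and it
    absorbs the quadratic terms of the drift estimate, so that one round
    increases it by at most (c sqrt T + Q(t).g^t(xhat)) / Y(t). When Y(t) is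
    above K sqrt T, the queues carry at least half of Y(t), and the
    conditional mean of this bound is a negative constant; for a small
    constant rate r, the exponential moment of Y then does not grow. Below
    K sqrt T, Y(t+1) is at most K' sqrt T. Hence E exp (r Y(t)) is at most
    t exp (r K' sqrt T) ([expR_potential_le]), and by a union bound over the
    rounds all queues are at most K' sqrt T + r^-1 log (2 T^2 / lambda) except
    on an event of probability lambda / 2 ([queue_tail]).

    Both exponential estimates multiply a function of the past by a function
    of the past and of the fresh sample. No conditional expectation is
    formed: the joint law of the past and of the fresh sample is a product,
    and integrating the sample first with the past frozen
    ([ge0_integral_freeze]) reduces the matter to a pointwise inequality.

    Finally the event in the conclusion has to be measurable: f^t(x(t)) is a
    random Lipschitz function at a random point ([measurable_fun_lipschitz]). *)

(** * Euclidean geometry and the proximal step *)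

Section euclidean.
Context {R : realType} {n : nat}.
Implicit Types (u v w x y z c : 'rV[R]_n) (a b t : R).

Lemma dotC u v : dot u v = dot v u.
Proof. by apply: eq_bigr => i _; rewrite mulrC. Qed.

Lemma dotDr u v w : dot u (v + w) = dot u v + dot u w.
Proof. by rewrite /dot -big_split; apply: eq_bigr => i _; rewrite mxE mulrDr. Qed.

Lemma dotZr a u v : dot u (a *: v) = a * dot u v.
Proof. by rewrite /dot mulr_sumr; apply: eq_bigr => i _; rewrite mxE mulrCA. Qed.

Lemma dotDl u v w : dot (v + w) u = dot v u + dot w u.
Proof. by rewrite dotC dotDr !(dotC u). Qed.

Lemma dotZl a u v : dot (a *: v) u = a * dot v u.
Proof. by rewrite dotC dotZr dotC. Qed.

Lemma dotNr u v : dot u (- v) = - dot u v.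
Proof. by rewrite -scaleN1r dotZr mulN1r. Qed.

Lemma dotNl u v : dot (- u) v = - dot u v.
Proof. by rewrite dotC dotNr dotC. Qed.

Lemma dot_suml (I : Type) (r : seq I) (F : I -> 'rV[R]_n) v :
  dot (\sum_(i <- r) F i) v = \sum_(i <- r) dot (F i) v.
Proof.
elim/big_rec2 : _ => [|i a u _ <-]; last by rewrite dotDl.
by rewrite /dot big1// => i _; rewrite mxE mul0r.
Qed.

Lemma dot_ge0 u : 0 <= dot u u.
Proof. by apply: sumr_ge0 => i _; rewrite -expr2 sqr_ge0. Qed.

Lemma enorm_ge0 u : 0 <= enorm u.
Proof. exact: sqrtr_ge0. Qed.

Lemma sqr_enorm u : enorm u ^+ 2 = dot u u.
Proof. by rewrite sqr_sqrtr ?dot_ge0. Qed.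

Lemma enormN u : enorm (- u) = enorm u.
Proof. by rewrite /enorm dotNl dotNr opprK. Qed.

Lemma enormBC u v : enorm (u - v) = enorm (v - u).
Proof. by rewrite -enormN opprB. Qed.

Lemma enormZ a u : enorm (a *: u) = `|a| * enorm u.
Proof.
by rewrite /enorm dotZl dotZr mulrA -expr2 sqrtrM ?sqr_ge0// sqrtr_sqr.
Qed.

Lemma cauchy_schwarz u v : `|dot u v| <= enorm u * enorm v.
Proof.
rewrite -ler_sqr ?nnegrE ?mulr_ge0 ?enorm_ge0//.
rewrite exprMn !sqr_enorm real_normK ?num_real//.
have [v0|] := eqVneq (dot v v) 0.
  suff -> : dot u v = 0 by rewrite expr0n mulr_ge0 ?dot_ge0.
  rewrite /dot big1// => i _; have /eqP := v0.
  rewrite psumr_eq0 => [/allP/(_ i)|j _]; last by rewrite -expr2 sqr_ge0.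
  by rewrite mem_index_enum mulf_eq0 orbb => /(_ isT)/eqP->; rewrite mulr0.
move=> v0; have {v0}vv : 0 < dot v v by rewrite lt_def v0 dot_ge0.
have := dot_ge0 (dot v v *: u - dot u v *: v).
rewrite dotDl !dotDr !(dotNl, dotNr, dotZl, dotZr) (dotC v u).
rewrite (_ : _ + _ = dot v v * (dot u u * dot v v - dot u v ^+ 2)); last by ring.
by rewrite pmulr_rge0// subr_ge0.
Qed.

Lemma normr_le_enorm u i : `|u ord0 i| <= enorm u.
Proof.
rewrite -ler_sqr ?nnegrE ?enorm_ge0// sqr_enorm real_normK ?num_real//.
rewrite /dot (bigD1 i)//= -expr2 lerDl sumr_ge0// => j _.
by rewrite -expr2 sqr_ge0.
Qed.

Lemma subgradient_lipschitz (A : set 'rV[R]_n) (h : 'rV[R]_n -> R) x y v D :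
  A y -> is_subgradient A h x v -> enorm v <= D ->
  h x <= h y + D * enorm (x - y).
Proof.
move=> Ay /(_ y Ay) hv vD; have := cauchy_schwarz v (y - x).
rewrite enormBC ler_norml => /andP[+ _] => cs.
have := ler_wpM2r (enorm_ge0 (x - y)) vD.
by lra.
Qed.

(** The objective is quadratic along the segment from the minimizer [x'] to
    [y]; minimality makes its slope at [x'] nonnegative, so moving to [y]
    costs at least the quadratic term. *)
Lemma proximal_step (A : set 'rV[R]_n) c a x x' y :
  convex_set A ->
  is_minimizer A (fun z => dot c (z - x) + a * enorm (z - x) ^+ 2) x' ->
  A y ->
  dot c (x' - x) + a * enorm (x' - x) ^+ 2 + a * enorm (y - x') ^+ 2 <=
  dot c (y - x) + a * enorm (y - x) ^+ 2.
Proof.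
move=> cA [Ax' minx'] Ay.
pose w := y - x'; pose k := dot c w + 2 * a * dot (x' - x) w.
have yE : y - x = x' - x + w by rewrite /w [RHS]addrC addrA subrK.
(* the objective along the segment, with slope k at x' *)
have moveE t : dot c (x' - x + t *: w) + a * enorm (x' - x + t *: w) ^+ 2 =
    dot c (x' - x) + a * enorm (x' - x) ^+ 2 + t * (k + t * (a * dot w w)).
  rewrite /k; clearbody w; clear k yE; move: (x' - x) w => p q.
  by rewrite !sqr_enorm !(dotDl, dotDr, dotZl, dotZr) (dotC q); ring.
have kt t : 0 < t -> t <= 1 -> 0 <= k + t * (a * dot w w).
  move=> t0 t1; have /set_mem Az : t *: y + (1 - t) *: x' \in A.
    exact: (cA y x' (Itv01 (ltW t0) t1) (mem_set Ay) (mem_set Ax')).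
  have := minx' _ Az.
  have -> : t *: y + (1 - t) *: x' - x = x' - x + t *: w.
    by apply/rowP => i; rewrite !mxE; ring.
  by rewrite moveE lerDl pmulr_rge0.
have k0 : 0 <= k.
  (* if k < 0, a short enough step along the segment decreases the objective *)
  rewrite leNgt; apply/negP => k0; have := kt 1 ltr01 (lexx _).
  rewrite mul1r => k1; set b := a * dot w w in kt k1.
  have b0 : 0 < b by lra.
  have den : 0 < 2 * b - k by lra.
  have t0 : 0 < - k / (2 * b - k) by rewrite divr_gt0 ?oppr_gt0.
  have t1 : - k / (2 * b - k) <= 1 by rewrite ler_pdivrMr// mul1r; lra.
  have := kt _ t0 t1; rewrite leNgt; apply/negP; rewrite negbK.
  have -> : k + - k / (2 * b - k) * b = k * (b - k) / (2 * b - k).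
    by field; rewrite gt_eqF.
  by rewrite pmulr_llt0 ?invr_gt0// nmulr_rlt0//; lra.
have := moveE 1; rewrite scale1r -yE !mul1r => ->.
by rewrite -/w lerD2l sqr_enorm lerDr.
Qed.

End euclidean.

(** * Independence of a fresh sample from the past *)

Section freezing.
Context {d dU : measure_display} {S : measurableType d} {U : measurableType dU}.
Context {R : realType}.

Lemma sub_sigma_gen_measurable (I : Type) (D : set I) (X : I -> S -> U) :
  (forall i, D i -> measurable_fun setT (X i)) ->
  sigma_gen D X `<=` measurable.
Proof.
move=> mX; apply: smallest_sub; first exact: sigma_algebra_measurable.
by move=> _ [i Di [B mB <-]]; exact: mX.
Qed.

(** Independence is given for finitely many events at a time, that is, for the
    cylinders over [J]. These are closed under intersection and generate the
    sigma-algebra of the variables indexed by [J], and the events that are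
    independent of [X t] form a Dynkin system. *)
Lemma mutually_independent_sigma_gen (P : probability S R) (D : set nat)
    (X : nat -> S -> U) (J : {fset nat}) (t : nat) :
  (forall i, D i -> measurable_fun setT (X i)) ->
  mutually_independent P D X -> [set` J] `<=` D -> D t -> t \notin J ->
  forall A B, sigma_gen [set` J] X A -> measurable B ->
  P (A `&` X t @^-1` B) = (P A * P (X t @^-1` B))%E.
Proof.
move=> mX indX JD Dt tJ A B sA mB.
pose cyl := [set C | exists2 B : nat -> set U, (forall i, measurable (B i)) &
  C = \bigcap_(i in [set` J]) X i @^-1` B i].
have mE : measurable (X t @^-1` B) by rewrite -[X in measurable X]setTI; exact: mX.
have cylI : setI_closed cyl.
  move=> _ _ [B1 mB1 ->] [B2 mB2 ->].
  exists (fun i => B1 i `&` B2 i) => [i|]; first exact: measurableI.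
  by rewrite -bigcapI.
have sub : <<s cyl >> `<=` measurable.
  apply: smallest_sub; first exact: sigma_algebra_measurable.
  move=> _ [C mC ->]; apply: bigcap_measurableType => i Ji.
  by rewrite -[X in measurable X]setTI; apply: mX => //; exact: JD.
have {}sA : <<s cyl >> A.
  apply: smallest_sub sA; first exact: smallest_sigma_algebra.
  move=> _ [i Ji [C mC <-]]; apply: sub_sigma_algebra.
  exists (fun j => if j == i then C else setT) => [j|]; first by case: eqP.
  rewrite setTI; apply/seteqP; split=> s /=; last by move/(_ i Ji); rewrite eqxx.
  by move=> Cs j Jj; case: eqP => // ->.
move: A sA; apply: (@dynkin_induction _ (g_sigma_algebraType cyl) cyl) => //.
- by rewrite setTI probability_setT mul1e.
- move=> _ [C mC ->].
  pose C' j := if j == t then B else C j.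
  have mC' j : measurable (C' j) by rewrite /C'; case: eqP.
  have -> : \bigcap_(i in [set` J]) X i @^-1` C i `&` X t @^-1` B =
     \bigcap_(i in [set` (t |` J)%fset]) X i @^-1` C' i.
    apply/seteqP; split=> s /=.
      move=> [Cs Bs] i; rewrite /C' /= !inE => /orP[/eqP->|Ji]; first by rewrite eqxx.
      by case: eqP => [->//|_]; exact: Cs.
    move=> Cs; split.
      move=> i Ji; have := Cs i; rewrite /= !inE Ji orbT => /(_ isT).
      by rewrite /C'; case: eqP Ji => // -> Ji; move: tJ; rewrite Ji.
    by have := Cs t; rewrite /= !inE eqxx => /(_ isT); rewrite /C' eqxx.
  rewrite indX//; last first.
    by move=> i; rewrite /= !inE => /orP[/eqP->//|]; exact: JD.
  rewrite indX// big_fsetU1//= {1}/C' eqxx muleC; congr (_ * _)%E.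
  rewrite !big_seq; apply: eq_bigr => i Ji; rewrite /C'; case: eqP => // it.
  by move: tJ; rewrite -it Ji.
- move=> A /sub mA PA.
  have -> : ~` A `&` X t @^-1` B = X t @^-1` B `\` (X t @^-1` B `&` A).
    by rewrite setDIr setDv set0U setDE setIC.
  rewrite measureD//; [|exact: measurableI|by rewrite -ge0_fin_numE ?fin_num_measure].
  rewrite setIA setIid [X in (_ - P X)%E]setIC.
  rewrite [X in (_ - X)%E]PA.
  rewrite probability_setC// muleBl ?mul1e//.
  by rewrite fin_num_measure.
- move=> F mF tF PF.
  have mF' n : measurable (F n : set S) := sub _ (mF n).
  rewrite setI_bigcupl measure_bigcup//; last 2 first.
  + by move=> n _; exact: measurableI.
  + by apply: trivIset_setIr.
  rewrite measure_bigcup// muleC -[X in (X * _)%E]fineK ?fin_num_measure//.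
  rewrite -nneseriesZl//.
  apply: eq_eseriesr => n _; rewrite fineK ?fin_num_measure//.
  by rewrite muleC; exact: PF.
Qed.

(** The sample space with the coarser sigma-algebra [<<s C>>] is the first
    factor of a product space. By independence the law of [s |-> (s, X s)] is
    the product of the restriction of [P] to [<<s C>>] and of [nu], and
    Tonelli's theorem applies. This plays the part of the conditional
    expectation given [<<s C>>]. *)
Lemma ge0_integral_freeze (P : probability S R) (nu : probability U R)
    (C : set (set S)) (X : S -> U) :
  <<s C >> `<=` measurable -> measurable_fun setT X ->
  (forall A B, <<s C >> A -> measurable B ->
     P (A `&` X @^-1` B) = (P A * nu B)%E) ->
  forall H : g_sigma_algebraType C * U -> \bar R,
  measurable_fun setT H -> (forall z, 0 <= H z)%E ->
  (\int[P]_s H (s, X s) = \int[P]_s \int[nu]_u H (s, u))%E.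
Proof.
move=> sC mX ind H mH H0.
have mid : measurable_fun setT (idfun : S -> g_sigma_algebraType C).
  by move=> _ A mA; rewrite setTI; exact: sC.
have mpair : measurable_fun setT
    (fun s : S => (s : g_sigma_algebraType C, X s)) by exact: measurable_fun_pair.
pose idRV : {RV P >-> g_sigma_algebraType C} :=
  HB.pack (idfun : S -> g_sigma_algebraType C) (isMeasurableFun.Build _ _ _ _ _ mid).
pose pairRV : {RV P >-> (g_sigma_algebraType C * U)%type} :=
  HB.pack (fun s : S => (s : g_sigma_algebraType C, X s))
    (isMeasurableFun.Build _ _ _ _ _ mpair).
have -> : (\int[P]_s H (s, X s) = \int[distribution P pairRV]_z H z)%E.
  by rewrite ge0_integral_distribution.
have <- : (\int[distribution P idRV \x nu]_z H z =
           \int[distribution P pairRV]_z H z)%E.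
  apply: eq_measure_integral => A mA _.
  apply: product_measure_unique => // B D mB mD.
rewrite fubini_tonelli1// ge0_integral_distribution//.
  exact: measurable_fun_fubini_tonelli_F.
by move=> s; exact: integral_ge0.
Qed.

End freezing.

(** * The drift-plus-penalty inequality *)

Section step.
Context {R : realType} {n m : nat}.

Lemma sum_mul_le_enorm (q h : 'I_m -> R) :
  `|\sum_k q k * h k| <= enorm (\row_k q k) * enorm (\row_k h k).
Proof.
apply: le_trans (cauchy_schwarz _ _); rewrite le_eqVlt; apply/orP; left.
by apply/eqP; congr `|_|; apply: eq_bigr => k _; rewrite !mxE.
Qed.

Lemma sqr_enorm_row (q : 'I_m -> R) : enorm (\row_k q k) ^+ 2 = \sum_k q k ^+ 2.
Proof. by rewrite sqr_enorm; apply: eq_bigr => k _; rewrite !mxE expr2. Qed.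

Lemma enorm_le_sum (q : 'I_m -> R) : (forall k, 0 <= q k) ->
  enorm (\row_k q k) <= \sum_k q k.
Proof.
move=> q0; rewrite -ler_sqr ?nnegrE ?enorm_ge0 ?sumr_ge0//.
rewrite sqr_enorm_row expr2 mulr_suml; apply: ler_sum => k _.
by rewrite expr2 ler_wpM2l// (bigD1 k)//= lerDl sumr_ge0.
Qed.

(** The right-hand side at a general comparison point [y] comes from comparing
    the proximal objective at its minimizer [x'] and at [y]. The last term
    gathers what is lost: [G ^+ 2 + m * (D2 * Rad) ^+ 2] bounds half of the sum
    of the squared queue increments, and [V ^+ 2 * D1 ^+ 2 / (4 * a)] is the
    largest value of [V * D1 * rho - a * rho ^+ 2], the part of the penalty
    that the quadratic term does not absorb when [x'] is at distance [rho]. *)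
Lemma drift_plus_penalty (A : set 'rV[R]_n) (V a D1 D2 G Rad fx fy : R)
    (x x' y v : 'rV[R]_n) (q q' gx gy : 'I_m -> R) (gd : 'I_m -> 'rV[R]_n) :
  convex_set A -> 0 <= V -> 0 < a -> 0 <= Rad ->
  is_minimizer A (fun z => V * dot v (z - x)
      + \sum_k q k * dot (gd k) (z - x) + a * enorm (z - x) ^+ 2) x' ->
  A y ->
  fx + dot v (y - x) <= fy -> enorm v <= D1 ->
  (forall k, gx k + dot (gd k) (y - x) <= gy k) ->
  (forall k, enorm (gd k) <= D2) ->
  enorm (\row_k gx k) <= G -> enorm (x' - x) <= Rad ->
  (forall k, 0 <= q k) ->
  (forall k, q' k = Num.max (q k + gx k + dot (gd k) (x' - x)) 0) ->
  2^-1 * enorm (\row_k q' k) ^+ 2 + a * enorm (y - x') ^+ 2 + V * (fx - fy) <=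
  2^-1 * enorm (\row_k q k) ^+ 2 + a * enorm (y - x) ^+ 2 + \sum_k q k * gy k
  + (G ^+ 2 + m%:R * (D2 * Rad) ^+ 2 + V ^+ 2 * D1 ^+ 2 / (4 * a)).
Proof.
move=> cA V0 a0 Rad0 minx' Ay fy_ge vD gy_ge gdD gxG xR q0 q'E.
pose c := V *: v + \sum_k q k *: gd k.
have cE z : dot c z = V * dot v z + \sum_k q k * dot (gd k) z.
  rewrite /c dotDl dotZl dot_suml; congr (_ + _).
  by apply: eq_bigr => k _; rewrite dotZl.
have := @proximal_step R n A c a x x' y cA.
have -> : (fun z => dot c (z - x) + a * enorm (z - x) ^+ 2) =
  (fun z => V * dot v (z - x)
      + \sum_k q k * dot (gd k) (z - x) + a * enorm (z - x) ^+ 2).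
  by apply/funext => z; rewrite cE.
move=> /(_ minx' Ay); rewrite !cE => step.
have queue : 2^-1 * enorm (\row_k q' k) ^+ 2 <= 2^-1 * enorm (\row_k q k) ^+ 2
   + \sum_k q k * gx k + \sum_k q k * dot (gd k) (x' - x)
   + (G ^+ 2 + m%:R * (D2 * Rad) ^+ 2).
  have : G ^+ 2 >= \sum_k gx k ^+ 2.
    by rewrite -sqr_enorm_row lerXn2r ?nnegrE ?(le_trans (enorm_ge0 _) gxG) ?enorm_ge0.
  have -> : m%:R * (D2 * Rad) ^+ 2 = \sum_(k < m) (D2 * Rad) ^+ 2.
    by rewrite sumr_const card_ord mulr_natl.
  rewrite !sqr_enorm_row !mulr_sumr => gG.
  rewrite addrCA; apply: le_trans (lerD gG (lexx _)).
  rewrite -!big_split/=; apply: ler_sum => k _; rewrite q'E.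
  set e := dot (gd k) (x' - x).
  have e_le : `|e| <= D2 * Rad.
    by apply: le_trans (cauchy_schwarz _ _) _; rewrite ler_pM// ?enorm_ge0.
  have e2 : e ^+ 2 <= (D2 * Rad) ^+ 2.
    by rewrite -[e ^+ 2]real_normK ?num_real// lerXn2r ?nnegrE ?(le_trans _ e_le).
  have max2 (z : R) : Num.max z 0 ^+ 2 <= z ^+ 2.
    by rewrite maxEle; case: ifP => _ //; rewrite [leLHS]expr2 mul0r sqr_ge0.
  have := max2 (q k + gx k + e); have := sqr_ge0 (gx k - e).
  rewrite !expr2 in e2 *; nra.
have lin : - (V ^+ 2 * D1 ^+ 2 / (4 * a)) <=
    V * dot v (x' - x) + a * enorm (x' - x) ^+ 2.
  set r := enorm (x' - x).
  have vr : V * dot v (x' - x) >= - (V * D1 * r).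
    rewrite -mulrA -mulrN ler_wpM2l//.
    have := cauchy_schwarz v (x' - x); rewrite ler_norml => /andP[+ _].
    by apply: le_trans; rewrite lerN2 ler_wpM2r ?enorm_ge0.
  have := sqr_ge0 (2 * a * r - V * D1).
  have -> : V ^+ 2 * D1 ^+ 2 / (4 * a) = (V * D1) ^+ 2 * (4 * a)^-1 by rewrite exprMn.
  have a4 : 0 < 4 * a by rewrite mulr_gt0.
  have -> : (2 * a * r - V * D1) ^+ 2 =
    (4 * a) * (a * r ^+ 2 - V * D1 * r + (V * D1) ^+ 2 * (4 * a)^-1).
    by field; rewrite gt_eqF.
  by rewrite pmulr_rge0//; lra.
have gle : \sum_k q k * gx k + \sum_k q k * dot (gd k) (y - x) <=
    \sum_k q k * gy k.
  rewrite -big_split/=; apply: ler_sum => k _.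
  by rewrite -mulrDr ler_wpM2l.
have fle : V * (fx + dot v (y - x)) <= V * fy by rewrite ler_wpM2l.
rewrite mulrDr in fle; rewrite mulrBr.
lra.
Qed.

End step.

(** * Exponential moments *)

Section moments.
Context {R : realType}.

(** Since the linear term on the right is integrated as it is, this
    inequality turns a bound on the mean of a bounded variable into a bound on
    its exponential moment, without any smallness condition. *)
Lemma expR_le_add_expR_sqr (x : R) : expR x <= x + expR (2 * x ^+ 2).
Proof.
have [x1|x1] := ltP 1 x.
  apply: (@le_trans _ _ (expR (2 * x ^+ 2))); last by rewrite lerDr; lra.
  by rewrite ler_expR; nra.
have sq := expR_ge1Dx (2 * x ^+ 2).
have [x0|x0] := leP x (-1).
  have : expR x <= 1 by rewrite expR_le1; lra.
  by nra.
suff : expR x <= 1 + x + 2 * x ^+ 2 by lra.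
(* exp x is the square of exp (x / 2), at most (1 - x / 2)^-1 *)
have half : 0 < 1 - x / 2 by lra.
have -> : x = x / 2 + x / 2 by lra.
rewrite expRD -expr2.
have le_inv : expR (x / 2) <= (1 - x / 2)^-1.
  rewrite -[x / 2]opprK expRN lef_pV2 ?posrE ?expR_gt0 ?opprK//.
  exact: expR_ge1Dx.
apply: (@le_trans _ _ ((1 - x / 2)^-1 ^+ 2)).
  by rewrite lerXn2r ?nnegrE ?expR_ge0 ?invr_ge0 ?(ltW half).
rewrite exprVn -[leLHS]mul1r ler_pdivrMr ?exprn_gt0//.
have -> : x / 2 + x / 2 = x by lra.
have : 0 <= (x - 1) * (x - 5 / 2) by nra.
have := sqr_ge0 x; rewrite !expr2; nra.
Qed.

Context {dU : measure_display} {U : measurableType dU}.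

Lemma integral_expR_le (nu : probability U R) (xi : U -> R) (b e : R) :
  measurable_fun setT xi -> (forall u, `|xi u| <= b) ->
  (\int[nu]_u (xi u)%:E <= e%:E)%E ->
  (\int[nu]_u (expR (xi u))%:E <= (expR (2 * b ^+ 2) + e)%:E)%E.
Proof.
move=> mxi xib ie.
have ixi : nu.-integrable setT (EFin \o xi).
  apply: measurable_bounded_integrable => //.
    by rewrite -ge0_fin_numE// fin_num_measure.
  exists b; split; first exact: num_real.
  by move=> M bM u _ /=; apply: le_trans (ltW bM).
have icst : nu.-integrable setT (EFin \o cst (expR (2 * b ^+ 2))).
  exact: finite_measure_integrable_cst.
apply: (@le_trans _ _
    (\int[nu]_u ((EFin \o cst (expR (2 * b ^+ 2))) u + (EFin \o xi) u)%E)%E).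
  apply: ge0_le_integral => //=.
  - by apply/measurable_EFinP; exact: measurableT_comp.
  - apply: emeasurable_funD; first exact: measurable_cst.
    exact/measurable_EFinP.
  - move=> u _; rewrite -EFinD lee_fin addrC.
    apply: le_trans (expR_le_add_expR_sqr _) _.
    rewrite lerD2l ler_expR ler_pM2l//.
    by rewrite -[xi u ^+ 2]real_normK ?num_real// lerXn2r ?nnegrE ?(le_trans _ (xib u)).
rewrite integralD//= EFinD leeD//.
by rewrite integral_cst//= probability_setT mule1.
Qed.

Lemma integral_weighted_sum_le (nu : probability U R) (m : nat)
    (h : 'I_m -> U -> R) (a : 'I_m -> R) (G e : R) :
  (forall k, measurable_fun setT (h k)) ->
  (forall u, enorm (\row_k h k u) <= G) ->
  (forall k, 0 <= a k) -> (forall k, \int[nu]_u (h k u)%:E <= e%:E)%E ->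
  (\int[nu]_u (\sum_k a k * h k u)%:E <= (e * \sum_k a k)%:E)%E.
Proof.
move=> mh hG a0 he.
have ih k : nu.-integrable setT (EFin \o h k).
  apply: measurable_bounded_integrable => //.
    by rewrite -ge0_fin_numE// fin_num_measure.
  exists G; split; first exact: num_real.
  move=> M GM u _ /=; apply: le_trans (ltW GM); apply: le_trans (hG u).
  by have := normr_le_enorm (\row_k h k u) k; rewrite mxE.
have iah k : nu.-integrable setT (fun u => (a k)%:E * (EFin \o h k) u)%E.
  exact: integrableZl.
rewrite (eq_integral (fun u => \sum_k ((a k)%:E * (EFin \o h k) u)%E)); last first.
  by move=> u _; rewrite -sumEFin.
rewrite integral_sum//= mulr_sumr -sumEFin; apply: lee_sum => k _.
by rewrite (integralZl _ (ih k))//= mulrC EFinM lee_wpmul2l// lee_fin.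
Qed.

Context {d : measure_display} {S : measurableType d}.

(** One step of an exponential martingale argument: [u] is the factor
    accumulated so far, [a] the weights given to the constraints at the fresh
    sample, both functions of the past; the pointwise hypothesis relating [u]
    and [w] is what the estimate of the inner integral leaves to check. *)
Lemma integral_exp_step (P : probability S R) (nu : probability U R)
    (C : set (set S)) (X : S -> U) (m : nat) (h : 'I_m -> U -> R)
    (a : 'I_m -> g_sigma_algebraType C -> R) (u : g_sigma_algebraType C -> R)
    (w : S -> R) (G b e : R) :
  <<s C >> `<=` measurable -> measurable_fun setT X ->
  (forall A B, <<s C >> A -> measurable B ->
     P (A `&` X @^-1` B) = (P A * nu B)%E) ->
  (forall k, measurable_fun setT (h k)) ->
  (forall o, enorm (\row_k h k o) <= G) ->
  (forall k, \int[nu]_o (h k o)%:E <= e%:E)%E ->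
  (forall k, measurable_fun setT (a k)) -> (forall k s, 0 <= a k s) ->
  (forall s, enorm (\row_k a k s) * G <= b) ->
  measurable_fun setT u -> (forall s, 0 <= u s) ->
  measurable_fun setT w ->
  (forall s, u s * (expR (2 * b ^+ 2) + e * \sum_k a k s) <= w s) ->
  (\int[P]_s (u s * expR (\sum_k a k s * h k (X s)))%:E <= \int[P]_s (w s)%:E)%E.
Proof.
move=> sC mX ind mh hG he ma a0 ab mu u0 mw uw.
pose H (z : g_sigma_algebraType C * U) :=
  (u z.1 * expR (\sum_k a k z.1 * h k z.2))%:E.
have mH : measurable_fun setT H.
  apply/measurable_EFinP; apply: measurable_funM; first exact: measurableT_comp.
  apply: measurableT_comp => //; apply: measurable_sum => k.
  by apply: measurable_funM; exact: measurableT_comp.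
have H0 z : (0 <= H z)%E by rewrite lee_fin mulr_ge0 ?expR_ge0.
have := ge0_integral_freeze sC mX ind mH H0; rewrite /H/= => ->.
have inner s : (\int[nu]_o (u s * expR (\sum_k a k s * h k o))%:E <= (w s)%:E)%E.
  under eq_integral do rewrite EFinM.
  have mexp : measurable_fun setT (fun o => \sum_k a k s * h k o).
    by apply: measurable_sum => k; apply: measurable_funM.
  rewrite ge0_integralZl//=.
  - apply: (@le_trans _ _ ((u s)%:E * (expR (2 * b ^+ 2) + e * \sum_k a k s)%:E)%E).
      rewrite lee_wpmul2l ?lee_fin//; apply: integral_expR_le => //.
        by move=> o; apply: le_trans (sum_mul_le_enorm _ _) _;
          apply: le_trans (ab s); rewrite ler_wpM2l ?enorm_ge0.
      exact: integral_weighted_sum_le hG _ _.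
    by rewrite -EFinM lee_fin.
  - by apply/measurable_EFinP; exact: measurableT_comp.
  - by rewrite lee_fin.
apply: ge0_le_integral => //=.
- by move=> s _; apply: integral_ge0 => o _; exact: H0 (s, o).
- have mF := measurable_fun_fubini_tonelli_F H (m2 := nu) mH H0.
  move=> _ B mB; apply: measurableI => //.
  by rewrite -[X in measurable X]setTI; apply: sC; exact: mF.
- exact/measurable_EFinP.
Qed.

End moments.

(** * Measurability of a Lipschitz function at a random point *)

Section enorm_topology.
Context {R : realType} {n : nat}.
Implicit Types u v x : 'rV[R]_n.

Lemma enormD u v : enorm (u + v) <= enorm u + enorm v.
Proof.
rewrite -ler_sqr ?nnegrE ?addr_ge0 ?enorm_ge0// sqrrD !sqr_enorm.
rewrite dotDl !dotDr (dotC v u).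
have := le_trans (ler_norm _) (cauchy_schwarz u v); lra.
Qed.

Lemma enorm_le_sum_normr u : enorm u <= \sum_i `|u ord0 i|.
Proof.
rewrite (_ : enorm u = enorm (\row_i `|u ord0 i|)); last first.
  congr Num.sqrt; apply: eq_bigr => i _.
  by rewrite !mxE -normrM ger0_norm -?expr2 ?sqr_ge0.
exact: enorm_le_sum.
Qed.

Lemma rational_dense x (e : R) : 0 < e ->
  exists q : 'rV[rat]_n, enorm (x - map_mx ratr q) < e.
Proof.
move=> e0; have d0 : 0 < e / n.+1%:R by rewrite divr_gt0.
have /choice[q qP] i : exists q : rat, ratr q \in `]x ord0 i, x ord0 i + e / n.+1%:R[.
  by apply: rat_in_itvoo; rewrite ltrDl.
exists (\row_i q i); apply: le_lt_trans (enorm_le_sum_normr _) _.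
apply: (@le_lt_trans _ _ (\sum_(i < n) e / n.+1%:R)).
  apply: ler_sum => i _; have := qP i; rewrite !mxE in_itv/= => /andP[q1 q2].
  by set dlt := e / _ in q2 *; rewrite ler0_norm; lra.
rewrite sumr_const card_ord -[_ *+ n]mulr_natr -mulrA gtr_pMr//.
by rewrite ltr_pdivrMl// mulr1 ltr_nat.
Qed.

Context {d : measure_display} {S : measurableType d}.

Lemma measurable_enorm (u : S -> 'rV[R]_n) :
  (forall i, measurable_fun setT (fun s => u s ord0 i)) ->
  measurable_fun setT (fun s => enorm (u s)).
Proof.
move=> mu; have msqrt : measurable_fun setT (@Num.sqrt R).
  exact: continuous_measurable_fun (@sqrt_continuous R).
apply: (measurableT_comp msqrt (g := fun s => dot (u s) (u s))).
by apply: measurable_sum => i; exact: measurable_funM.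
Qed.

(** The random point is approximated by points of [A] where [h] is known to be
    measurable. The value at [x s] is below [c] exactly when
    [h s z + D * enorm (x s - z) < c] for some [z] in a countable dense subset
    of [A]: the Lipschitz bound gives one direction, density the other. *)
Lemma measurable_fun_lipschitz (A : set 'rV[R]_n) (D : R)
    (h : S -> 'rV[R]_n -> R) (x : S -> 'rV[R]_n) :
  0 < D ->
  (forall z, A z -> measurable_fun setT (h ^~ z)) ->
  (forall s y z, A y -> A z -> h s y <= h s z + D * enorm (y - z)) ->
  (forall s, A (x s)) -> (forall i, measurable_fun setT (fun s => x s ord0 i)) ->
  measurable_fun setT (fun s => h s (x s)).
Proof.
move=> D0 mh lip Ax mx.
(* A may have empty interior and contain no rational vector: for every
   rational vector q and precision j^-1, some point of A as close to q as this,
   if there is one, belongs to the countable dense subset. *)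
have /choice[pick pickP] (i : 'rV[rat]_n * nat) : exists z, A z /\
    ((exists2 y, A y & enorm (map_mx ratr i.1 - y) < i.2.+1%:R^-1) ->
     enorm (map_mx ratr i.1 - z) < i.2.+1%:R^-1).
  have [[y Ay yi]|no] := pselect (exists2 y, A y &
    enorm (map_mx ratr i.1 - y) < i.2.+1%:R^-1); first by exists y.
  by exists (x point); split.
move=> mT; apply: (measurability _ (RGenInftyO.measurableE R)) => //.
move=> _ [_ [c ->] <-]; rewrite setTI.
rewrite (_ : _ @^-1` _ = \bigcup_i
    [set s | h s (pick i) + D * enorm (x s - pick i) < c]); last first.
  apply/seteqP; split=> s /=; rewrite ?in_itv/=.
    move=> hc; have e0 : 0 < (c - h s (x s)) / (4 * D).
      by rewrite divr_gt0 ?subr_gt0 ?mulr_gt0.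
    have [j] := ltr_add_invr e0; rewrite add0r => je.
    have [|q qx] := @rational_dense (x s) j.+1%:R^-1; first by [].
    exists (q, j) => //=; have [Ap /= pq] := pickP (q, j).
    have {}pq := pq (ex_intro2 _ _ _ (Ax s) _).
    rewrite (enormBC _ (x s)) in pq; have {}pq := pq qx.
    have := lip s _ _ Ap (Ax s); rewrite enormBC.
    have : enorm (x s - pick (q, j)) <= j.+1%:R^-1 + j.+1%:R^-1.
      rewrite -[x s](subrK (map_mx ratr q)) -addrA.
      apply: le_trans (enormD _ _) _; exact: lerD (ltW _) (ltW _).
    move=> /(ler_wpM2l (ltW D0)); rewrite ltr_pdivlMr ?mulr_gt0// in je.
    by move: je; set r := _^-1; lra.
  move=> [i _ /=]; apply: le_lt_trans; have [Ap _] := pickP i.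
  exact: lip.
apply: countable_bigcupT_measurable => // i; have [Ap _] := pickP i.
rewrite -[X in measurable X]setTI; apply: (measurable_fun_ltr _ _ measurableT) => //.
apply: measurable_funD; first exact: mh.
apply: measurable_funM => //; apply: measurable_enorm => k.
under eq_fun do rewrite !mxE.
exact: measurable_funB.
Qed.

End enorm_topology.

(** * Sums weighted by the past *)

Section weighted_samples.
Context {R : realType} {dU : measure_display} {U : measurableType dU}.
Context {d : measure_display} {S : measurableType d} {m : nat}.
Context {P : probability S R} {nu : probability U R}.
Context {F : nat -> set (set S)} {X : nat -> S -> U}.
(* [F t] generates the sigma-algebra of what is known before [X t] is drawn. *)
Hypothesis F_measurable : forall t, (1 <= t)%N -> <<s F t >> `<=` measurable.
Hypothesis X_measurable : forall t, (1 <= t)%N -> measurable_fun setT (X t).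
Hypothesis X_fresh : forall t A B, (1 <= t)%N -> <<s F t >> A -> measurable B ->
  P (A `&` X t @^-1` B) = (P A * nu B)%E.
Context {h : 'I_m -> U -> R} {G : R}.
Hypothesis G_gt0 : 0 < G.
Hypothesis h_measurable : forall k, measurable_fun setT (h k).
Hypothesis h_bounded : forall u, enorm (\row_k h k u) <= G.

Lemma measurable_fun_sub_sigma dV (V : measurableType dV) (C : set (set S))
    (Y : S -> V) :
  <<s C >> `<=` measurable ->
  measurable_fun (setT : set (g_sigma_algebraType C)) Y -> measurable_fun setT Y.
Proof. by move=> sC mY _ B mB; apply: sC; exact: mY. Qed.

Lemma markov_expR (Y : S -> R) (r z : R) : 0 < r -> measurable_fun setT Y ->
  (P [set s | (z <= Y s)%R] <=
   (expR (- (r * z)))%:E * \int[P]_s (expR (r * Y s))%:E)%E.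
Proof.
move=> r0 mY.
pose YRV : {RV P >-> R} := HB.pack Y (isMeasurableFun.Build _ _ _ _ _ mY).
have := chernoff YRV z r0; rewrite /mmt_gen_fun unlock muleC/=.
by under [X in (_ * X)%E]eq_integral do rewrite /= mulrC.
Qed.

(** An inequality of Azuma type: every round multiplies the exponential moment
    by at most [expR (2 * (r * b) ^+ 2)], because the increment
    is bounded by [b] and has nonpositive mean given the past. *)
Lemma expR_weighted_sum_le (a : nat -> S -> 'I_m -> R) (b r : R) N :
  (forall t t', (1 <= t < t')%N ->
     measurable_fun (setT : set (g_sigma_algebraType (F t'))) (X t)) ->
  (forall t t' k, (1 <= t <= t')%N ->
     measurable_fun (setT : set (g_sigma_algebraType (F t'))) (fun s => a t s k)) ->
  (forall t s k, (1 <= t)%N -> 0 <= a t s k) ->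
  (forall t s, (1 <= t)%N -> enorm (\row_k a t s k) * G <= b) ->
  (forall k, \int[nu]_u (h k u)%:E <= 0)%E -> 0 <= r ->
  (\int[P]_s (expR (r * \sum_(1 <= t < N.+1) \sum_k a t s k * h k (X t s)))%:E <=
   (expR (N%:R * (2 * (r * b) ^+ 2)))%:E)%E.
Proof.
move=> X_past a_past a0 ab h0 r0.
elim: N => [|N IH].
  under eq_integral do rewrite big_geq// mulr0 expR0.
  by rewrite integral_cst//= probability_setT mul0r expR0 mule1.
pose Z s := \sum_(1 <= t < N.+1) \sum_k a t s k * h k (X t s).
have mZ : measurable_fun (setT : set (g_sigma_algebraType (F N.+1))) Z.
  have -> : Z = fun s => \sum_(t < N) \sum_k a t.+1 s k * h k (X t.+1 s).
    by apply/funext => s; rewrite /Z big_add1 big_mkord.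
  apply: measurable_sum => t; apply: measurable_sum => k.
  apply: measurable_funM; first by apply: a_past; rewrite /= ltnW ?ltnS ?ltn_ord.
  by apply: measurableT_comp => //; apply: X_past; rewrite /= ltnS.
have mexp r' : measurable_fun (setT : set (g_sigma_algebraType (F N.+1)))
    (fun s => expR (r' * Z s)).
  by apply: measurableT_comp => //; exact: measurable_funM.
apply: (@le_trans _ _ (\int[P]_s (expR (r * Z s) * expR (2 * (r * b) ^+ 2))%:E)%E).
  have -> : (fun s => (expR (r * \sum_(1 <= t < N.+2)
      \sum_k a t s k * h k (X t s)))%:E) =
    (fun s => (expR (r * Z s) *
      expR (\sum_k (r * a N.+1 s k) * h k (X N.+1 s)))%:E).
    apply/funext => s; rewrite big_nat_recr//= mulrDr expRD; congr (_ * expR _)%:E.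
    by rewrite mulr_sumr; apply: eq_bigr => k _; rewrite mulrA.
  apply: (@integral_exp_step _ _ _ _ _ P nu (F N.+1) (X N.+1) m h
    (fun k s => r * a N.+1 s k) (fun s => expR (r * Z s)) _ G (r * b) 0).
  - exact: F_measurable.
  - exact: X_measurable.
  - by move=> A B; exact: X_fresh.
  - exact: h_measurable.
  - exact: h_bounded.
  - exact: h0.
  - by move=> k; apply: measurable_funM => //; apply: a_past; rewrite /= leqnn.
  - by move=> k s; rewrite mulr_ge0// a0.
  - move=> s; have -> : \row_k (r * a N.+1 s k) = r *: \row_k a N.+1 s k.
      by apply/rowP => k; rewrite !mxE.
    by rewrite enormZ ger0_norm// -mulrA ler_wpM2l// ab.
  - exact: mexp.
  - by move=> s; exact: expR_ge0.
  - apply: measurable_funM => //.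
    exact: measurable_fun_sub_sigma (F_measurable _) (mexp r).
  - by move=> s; rewrite mul0r addr0.
under eq_integral do rewrite mulrC EFinM.
rewrite ge0_integralZl//=; last first.
- apply/measurable_EFinP; exact: measurable_fun_sub_sigma (F_measurable _) (mexp r).
have -> : N.+1%:R * (2 * (r * b) ^+ 2) =
  2 * (r * b) ^+ 2 + N%:R * (2 * (r * b) ^+ 2) by rewrite -natr1; ring.
rewrite [in leRHS]expRD EFinM lee_wpmul2l//.
Qed.

(** Above [kappa] the drift inequality, divided by [Y t], bounds the increment
    of [Y] by [L / Y t <= e / 4] plus the weighted constraints
    [\sum_k q k / Y t * h k]. The hypothesis on [w] gives
    [enorm q >= Y t / 2], so these have mean at most [- e / 2] given the past,
    and the exponential moment does not increase if [r] is so small that the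
    second-order term is at most [r * e / 4]. Below [kappa] the next value is
    at most [M], and each round adds at most [expR (r * M)]. *)
Lemma expR_potential_le (q : nat -> S -> 'I_m -> R) (Y : nat -> S -> R)
    (e L w kappa M r : R) t :
  (forall t k, (1 <= t)%N ->
     measurable_fun (setT : set (g_sigma_algebraType (F t))) (fun s => q t s k)) ->
  (forall t, (1 <= t)%N ->
     measurable_fun (setT : set (g_sigma_algebraType (F t))) (Y t)) ->
  (forall t s k, (1 <= t)%N -> 0 <= q t s k) ->
  (forall t s, (1 <= t)%N -> enorm (\row_k q t s k) <= Y t s) ->
  (forall t s, (1 <= t)%N -> Y t s ^+ 2 <= enorm (\row_k q t s k) ^+ 2 + w) ->
  (forall t s, (1 <= t)%N -> Y t.+1 s ^+ 2 <=
     Y t s ^+ 2 + 2 * (L + \sum_k q t s k * h k (X t s))) ->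
  (forall k, \int[nu]_u (h k u)%:E <= (- e)%:E)%E ->
  0 < e -> 0 < kappa -> 0 <= L -> 4 * L <= e * kappa -> 2 * w <= kappa ^+ 2 ->
  0 <= M -> kappa ^+ 2 + 2 * (L + kappa * G) <= M ^+ 2 ->
  (forall s, Y 1%N s <= M) ->
  0 < r -> 16 * r * G ^+ 2 <= e -> 2 * r * G <= 1 ->
  (1 <= t)%N ->
  (\int[P]_s (expR (r * Y t s))%:E <= (t%:R * expR (r * M))%:E)%E.
Proof.
move=> mq mY q0 qY Yq drift he e0 k0 L0 Lk wk M0 kM Y1 r0 rG2 rG.
have mexpY j : (1 <= j)%N ->
    measurable_fun (setT : set S) (fun s => (expR (r * Y j s))%:E).
  move=> j1; apply/measurable_EFinP; apply: measurableT_comp => //.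
  apply: measurable_funM => //.
  exact: measurable_fun_sub_sigma (F_measurable j1) (mY _ j1).
have Y_ge0 j s : (1 <= j)%N -> 0 <= Y j s.
  by move=> j1; apply: le_trans (qY j s j1); exact: enorm_ge0.
case: t => [//|t] _; elim: t => [|t IH].
  rewrite mul1r; apply: (@le_trans _ _ (\int[P]_s (expR (r * M))%:E)%E).
    apply: ge0_le_integral => //=; first exact: mexpY.
    by move=> s _; rewrite lee_fin ler_expR ler_pM2l.
  by rewrite integral_cst//= probability_setT mule1.
pose big s := kappa <= Y t.+1 s.
pose u s := if big s then expR (r * (Y t.+1 s + e / 4)) else 0.
pose a k s := if big s then r * (q t.+1 s k / Y t.+1 s) else 0.
have aE s : \row_k a k s =
    (if big s then r / Y t.+1 s else 0) *: \row_k q t.+1 s k.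
  by apply/rowP => k; rewrite !mxE /a; case: ifP => _; rewrite ?mul0r// mulrA mulrAC.
have Ypos s : big s -> 0 < Y t.+1 s by move=> ?; exact: lt_le_trans k0 _.
have mbig : measurable_fun (setT : set (g_sigma_algebraType (F t.+1))) big.
  by apply: measurable_fun_ler => //; exact: mY.
have ma k : measurable_fun (setT : set (g_sigma_algebraType (F t.+1))) (a k).
  apply: measurable_fun_ifT => //.
  apply: measurable_funM => //; apply: measurable_funM; first exact: mq.
  under eq_fun do rewrite -(powR_inv1 (Y_ge0 t.+1 _ isT)).
  by apply: (measurableT_comp (measurable_powR (-1))); exact: mY.
have mu : measurable_fun (setT : set (g_sigma_algebraType (F t.+1))) u.
  apply: measurable_fun_ifT => //; apply: measurableT_comp => //.
  by apply: measurable_funM => //; apply: measurable_funD => //; exact: mY.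
have step : (\int[P]_s (u s * expR (\sum_k a k s * h k (X t.+1 s)))%:E <=
    \int[P]_s (expR (r * Y t.+1 s))%:E)%E.
  apply: (@integral_exp_step _ _ _ _ _ P nu (F t.+1) (X t.+1) m h a u _
    G (r * G) (- e)).
  - exact: F_measurable.
  - exact: X_measurable.
  - by move=> A B; exact: X_fresh.
  - exact: h_measurable.
  - exact: h_bounded.
  - exact: he.
  - exact: ma.
  - move=> k s; rewrite /a; case: ifP => // _.
    by rewrite mulr_ge0 ?(ltW r0)// divr_ge0 ?q0 ?Y_ge0.
  - move=> s; rewrite ler_wpM2r ?(ltW G_gt0)// aE enormZ.
    case: ifP => [b|_]; last by rewrite normr0 mul0r ltW.
    rewrite ger0_norm ?divr_ge0 ?(ltW r0) ?Y_ge0// mulrAC ler_pdivrMr ?Ypos//.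
    by rewrite ler_pM2l// qY.
  - exact: mu.
  - by move=> s; rewrite /u; case: ifP => _ //; exact: expR_ge0.
  - exact/measurable_EFinP/mexpY.
  - move=> s; rewrite /u; case: ifPn => [b|_]; last by rewrite mul0r expR_ge0.
    have Yp := Ypos s b.
    have half : 2^-1 * r <= \sum_k a k s.
      have norm_q : 2^-1 * Y t.+1 s <= enorm (\row_k q t.+1 s k).
        rewrite -ler_sqr ?nnegrE ?mulr_ge0 ?enorm_ge0 ?invr_ge0 ?(ltW Yp)//.
        have := Yq t.+1 s isT.
        have : kappa ^+ 2 <= Y t.+1 s ^+ 2.
          by rewrite lerXn2r ?nnegrE ?(ltW k0) ?(ltW Yp).
        have := sqr_ge0 (Y t.+1 s); rewrite exprMn expr2; lra.
      have := le_trans norm_q (enorm_le_sum (fun k => q0 t.+1 s k isT)) => le.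
      have -> : \sum_k a k s = r / Y t.+1 s * \sum_k q t.+1 s k.
        by rewrite mulr_sumr; apply: eq_bigr => k _; rewrite /a b mulrA mulrAC.
      rewrite mulrC -mulrA ler_pM2l// ler_pdivlMl// mulrC.
      by [].
    have small : expR (2 * (r * G) ^+ 2) <= 1 + r * e / 4.
      have y1 : 2 * (r * G) ^+ 2 <= 2^-1.
        have : (r * G) ^+ 2 <= 2^-1 ^+ 2.
          by rewrite lerXn2r ?nnegrE ?mulr_ge0 ?(ltW r0) ?(ltW G_gt0) ?invr_ge0//; lra.
        rewrite expr2; lra.
      have y2 : 4 * (r * G) ^+ 2 <= r * e / 4.
        have : r * (16 * r * G ^+ 2) <= r * e by rewrite ler_pM2l.
        by rewrite exprMn !expr2; lra.
      have y0 : 0 <= (r * G) ^+ 2 := sqr_ge0 _.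
      move: ((r * G) ^+ 2) y0 y1 y2 => y y0 y1 y2.
      have inv : expR (2 * y) <= (1 - 2 * y)^-1.
        rewrite -[2 * y]opprK expRN lef_pV2 ?posrE ?expR_gt0 ?opprK//; last by lra.
        exact: expR_ge1Dx.
      apply: le_trans inv _; rewrite -[leLHS]mul1r ler_pdivrMr; last by lra.
      by nra.
    rewrite (mulrDr r) expRD -[leRHS]mulr1 -mulrA ler_pM2l ?expR_gt0//.
    (* 1 + r e / 4 - r e / 2 = 1 - r e / 4 *)
    have z : expR (r * (e / 4)) * (1 - r * (e / 4)) <= 1.
      rewrite -ler_pdivlMl ?expR_gt0// mulr1 -expRN; exact: expR_ge1Dx.
    apply: le_trans z; rewrite ler_pM2l ?expR_gt0//.
    have : e * (2^-1 * r) <= e * \sum_k a k s by rewrite ler_pM2l.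
    rewrite mulNr; lra.
have pathwise s : expR (r * Y t.+2 s) <=
    u s * expR (\sum_k a k s * h k (X t.+1 s)) + expR (r * M).
  set xi := \sum_k q t.+1 s k * h k (X t.+1 s).
  rewrite /u; case: ifPn => b.
    have Yp := Ypos s b.
    have -> : \sum_k a k s * h k (X t.+1 s) = r * (xi / Y t.+1 s).
      rewrite /xi mulr_suml mulr_sumr; apply: eq_bigr => k _; rewrite /a b.
      by rewrite -[LHS]mulrA mulrAC.
    apply: (@le_trans _ _
      (expR (r * (Y t.+1 s + e / 4)) * expR (r * (xi / Y t.+1 s)))); last first.
      by rewrite lerDl expR_ge0.
    rewrite -expRD ler_expR -mulrDr ler_pM2l//.
    have LY : L / Y t.+1 s <= e / 4.
      rewrite ler_pdivrMr//; have : e * kappa <= e * Y t.+1 s by rewrite ler_pM2l.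
      lra.
    (* the square root lies below its tangent at Y t ^+ 2 *)
    have le1 : Y t.+2 s <= Y t.+1 s + (L + xi) / Y t.+1 s.
      have := drift t.+1 s isT; rewrite -/xi.
      have -> : Y t.+1 s ^+ 2 + 2 * (L + xi) =
        (Y t.+1 s + (L + xi) / Y t.+1 s) ^+ 2 - ((L + xi) / Y t.+1 s) ^+ 2.
        by field; rewrite gt_eqF.
      set dlt := (L + xi) / _ => sq.
      have [dpos|dneg] := leP 0 (Y t.+1 s + dlt).
        rewrite -ler_sqr ?nnegrE ?Y_ge0//; apply: le_trans sq _.
        by rewrite gerBl sqr_ge0.
      have := Y_ge0 t.+2 s isT; have := sqr_ge0 (Y t.+2 s); nra.
    rewrite mulrDl in le1; lra.
  rewrite mul0r add0r ler_expR ler_pM2l//.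
  rewrite -ler_sqr ?nnegrE ?Y_ge0//; apply: le_trans kM.
  apply: le_trans (drift t.+1 s isT) _; rewrite -ltNge in b.
  have Y0 := Y_ge0 t.+1 s isT.
  apply: lerD; first by rewrite lerXn2r ?nnegrE ?(ltW k0) ?(ltW b).
  rewrite ler_pM2l// lerD2l -/xi; apply: le_trans (ler_norm _) _.
  apply: le_trans (sum_mul_le_enorm _ _) _.
  by apply: ler_pM; rewrite ?enorm_ge0// (le_trans (qY t.+1 s isT)) ?(ltW b).
have mupart : measurable_fun (setT : set S)
    (fun s => (u s * expR (\sum_k a k s * h k (X t.+1 s)))%:E).
  apply/measurable_EFinP; apply: measurable_funM.
    exact: measurable_fun_sub_sigma (F_measurable _) mu.
  apply: measurableT_comp => //; apply: measurable_sum => k.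
  apply: measurable_funM; first exact: measurable_fun_sub_sigma (F_measurable _) (ma k).
  by apply: measurableT_comp => //; exact: X_measurable.
apply: (@le_trans _ _ (\int[P]_s ((u s * expR (\sum_k a k s * h k (X t.+1 s)))%:E
   + (expR (r * M))%:E)%E)%E).
  apply: ge0_le_integral => //=; first exact: mexpY.
    by apply: emeasurable_funD.
  by move=> s _; rewrite -EFinD lee_fin pathwise.
rewrite ge0_integralD//=; last first.
  move=> s _; rewrite lee_fin mulr_ge0 ?expR_ge0// /u.
  by case: ifP => // _; rewrite expR_ge0.
rewrite integral_cst//= probability_setT mule1 -[t.+2%:R]natr1 mulrDl mul1r EFinD.
rewrite leeD2r//; exact: le_trans step IH.
Qed.

End weighted_samples.

(** * The history of the samples *)

Section history.
Context {R : realType} {dO : measure_display} {Omega : measurableType dO}.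
Context {d : measure_display} {S : measurableType d} {P : probability S R}.
Variable omega : nat -> {RV P >-> Omega}.

(** [<<s past t >>] is [history omega t.-1]: the rounds start at 1, and round
    [t] is played before [omega t] is observed. *)
Definition past t : set (set S) :=
  \bigcup_(tau in [set tau | (1 <= tau <= t.-1)%N])
    preimage_set_system setT (omega tau) measurable.

Lemma past_measurable t : <<s past t >> `<=` measurable.
Proof. exact: sub_sigma_gen_measurable. Qed.

Lemma measurable_wrt_history dV (V : measurableType dV) (h : S -> V) t t' :
  measurable_wrt (history omega t.-1) h -> (t <= t')%N ->
  measurable_fun (setT : set (g_sigma_algebraType (past t'))) h.
Proof.
move=> mh tt' _ B mB; rewrite setTI.
apply: sub_sigma_algebra2 (mh _ mB) => _ [tau /andP[t1 tt] [D mD <-]].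
exists tau; last by exists D.
by rewrite /= t1 (leq_trans tt)//; case: t t' {mh tt} tt' => [|t] [|t'].
Qed.

Lemma sample_past_measurable t t' : (1 <= t < t')%N ->
  measurable_fun (setT : set (g_sigma_algebraType (past t'))) (omega t).
Proof.
move=> /andP[t1 tt'] _ B mB; rewrite setTI; apply: sub_sigma_algebra.
exists t; last by exists B => //; rewrite setTI.
by rewrite /= t1; case: t' tt'.
Qed.

Lemma sample_fresh (nu : probability Omega R) t A B : iid_samples nu omega ->
  (1 <= t)%N -> <<s past t >> A -> measurable B ->
  P (A `&` omega t @^-1` B) = (P A * nu B)%E.
Proof.
move=> iid t1 sA mB; rewrite -(samples_law iid t1 mB).
pose J := [fset tau in iota 1 t.-1]%fset.
have JE : [set` J] = [set tau | (1 <= tau <= t.-1)%N].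
  by apply/seteqP; split=> tau; rewrite /= !inE mem_iota add1n ltnS.
apply: (mutually_independent_sigma_gen (J := J) _ (samples_independent iid)) => //.
- by rewrite JE => tau /= /andP[].
- by rewrite !inE mem_iota add1n ltnS; case: t t1 {sA J JE} => //= t _; rewrite ltnn.
- by rewrite JE.
Qed.

End history.

(** * The order of the regret bound *)

Section constants.
Context {R : realType}.

Lemma ln2_le1 : ln 2 <= 1 :> R.
Proof.
by rewrite -ler_expR lnK ?posrE//; have := @expR_ge1Dx R 1; lra.
Qed.

(** [sT], [MT] and [ML] stand for [sqrt T], [log T] and [log (1 / lambda)],
    all at least 1; [q] is the bound on the queues and
    [q * G * Num.sqrt (8 * l)] the deviation of the truncated sum divided by
    [sqrt T]. The factor [ML * Num.sqrt ML] is the power 3/2: one [ML] comes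
    from [q], and the root from the deviation. *)
Lemma regret_constant_le (sT MT ML l r A K G : R) (q : R) :
  1 <= sT -> 1 <= MT -> 1 <= ML -> 0 < r -> 0 <= A -> 0 <= K -> 0 <= G ->
  0 <= l -> l <= 2 * ML ->
  q <= K * sT + r^-1 * (1 + 2 * MT + ML) ->
  sT * A + q * G * Num.sqrt (8 * l) <=
  (A + 4 * G * (K + 4 / r)) * (sT * MT * (ML * Num.sqrt ML)).
Proof.
move=> sT1 MT1 ML1 r0 A0 K0 G0 l0 lML qle.
have sML1 : 1 <= Num.sqrt ML by rewrite -[leLHS]sqrtr1 ler_sqrt// (le_trans ler01).
have rI : 0 < r^-1 by rewrite invr_gt0.
have sT0 : 0 <= sT by exact: le_trans ler01 _.
have MT0 : 0 <= MT by exact: le_trans ler01 _.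
have ML0 : 0 <= ML by exact: le_trans ler01 _.
have sML0 : 0 <= Num.sqrt ML by exact: sqrtr_ge0.
have p1 : sT <= sT * MT by rewrite ler_peMr.
have p2 : MT <= sT * MT by rewrite ler_peMl.
have MM : 1 <= MT * ML by rewrite mulr_ege1.
have q1 : q <= (K + 4 / r) * (sT * MT * ML).
  apply: le_trans qle _; rewrite [leRHS]mulrDl; apply: lerD.
    by rewrite ler_wpM2l// -mulrA ler_peMr.
  rewrite [4 / r]mulrC -[leRHS]mulrA ler_pM2l//.
  have : MT * ML <= sT * (MT * ML) by rewrite ler_peMl// mulr_ge0.
  have : MT <= MT * ML by rewrite ler_peMr.
  have : ML <= MT * ML by rewrite ler_peMl.
  rewrite -mulrA; lra.
have sl : Num.sqrt (8 * l) <= 4 * Num.sqrt ML.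
  have -> : 4 = Num.sqrt (4 ^+ 2) :> R by rewrite sqrtr_sqr ger0_norm.
  rewrite -sqrtrM ?sqr_ge0// ler_sqrt ?mulr_ge0 ?sqr_ge0//.
  by rewrite expr2; lra.
rewrite [leRHS]mulrDl; apply: lerD.
  rewrite [leLHS]mulrC ler_wpM2l//; apply: le_trans p1 _.
  by rewrite ler_peMr ?mulr_ge0// mulr_ege1.
apply: (@le_trans _ _ (((K + 4 / r) * (sT * MT * ML)) * G * (4 * Num.sqrt ML))).
  apply: (@le_trans _ _ (((K + 4 / r) * (sT * MT * ML)) * G * Num.sqrt (8 * l))).
    by rewrite ler_wpM2r ?sqrtr_ge0// ler_wpM2r.
  rewrite ler_wpM2l// !mulr_ge0// addr_ge0// divr_ge0// ltW//.
by rewrite le_eqVlt; apply/orP; left; apply/eqP; ring.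
Qed.

End constants.

(** * The run of the algorithm *)

Section run.
Context {R : realType} {n m : nat} {D1 D2 G Rad eps : R}.
Context {X0 : set 'rV[R]_n} {dO : measure_display} {Omega : measurableType dO}.
Context {mu : probability Omega R}.
Context {g : 'I_m -> 'rV[R]_n -> Omega -> R}.
Context {gradg : 'I_m -> 'rV[R]_n -> Omega -> 'rV[R]_n}.
Context {d : measure_display} {S : measurableType d} {P : probability S R}.
Context {omega : nat -> {RV P >-> Omega}}.
Context {T : nat} {f : nat -> S -> 'rV[R]_n -> R}.
Context {gradf : nat -> S -> 'rV[R]_n -> 'rV[R]_n}.
Context {x : nat -> S -> 'rV[R]_n} {Q : nat -> S -> 'I_m -> R}.
Hypotheses (D1_gt0 : 0 < D1) (G_gt0 : 0 < G) (Rad_gt0 : 0 < Rad).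
Hypothesis eps_gt0 : 0 < eps.
Hypothesis domain : bounded_domain X0 Rad.
Hypothesis constraints : constraint_functions X0 g gradg D2 G.
Hypothesis T_gt0 : (1 <= T)%N.
Hypothesis losses : loss_functions X0 omega f gradf D1.
Hypothesis iid : iid_samples mu omega.
Hypothesis adapted : adapted_run omega x Q.
Hypothesis run : algorithm1 X0 g gradg omega gradf (Num.sqrt T%:R) T%:R x Q.

Definition queue_norm t s : R := enorm (\row_k Q t s k).

Definition queued_constraints y t s : R := \sum_k Q t s k * g k y (omega t s).

Definition drift_const : R := G ^+ 2 + m%:R * (D2 * Rad) ^+ 2 + D1 ^+ 2 / 4.

(** The second term makes the proximal terms of [round_drift] part of the
    potential, so that the drift of a single round is already negative. *)
Definition potential y t s : R :=
  Num.sqrt (queue_norm t s ^+ 2 + 2 * T%:R * enorm (y - x t s) ^+ 2).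

Let sqrtT_ge1 : 1 <= Num.sqrt T%:R :> R.
Proof. by rewrite -[leLHS]sqrtr1 ler_sqrt ?ler1n// ler0n. Qed.

Let sqr_sqrtT : Num.sqrt T%:R ^+ 2 = T%:R :> R.
Proof. by rewrite sqr_sqrtr. Qed.

Let T_gt0R : 0 < T%:R :> R. Proof. by rewrite ltr0n. Qed.

Lemma decision_in_domain t s : (1 <= t)%N -> X0 (x t s).
Proof.
case: t => [//|[|t]] _; first exact: decision_init run s.
by have [] := @decision_step _ _ _ _ _ _ _ _ _ _ _ _ _ _ _ _ _ run t.+1 s isT.
Qed.

Lemma queue_ge0 t s k : (1 <= t)%N -> 0 <= Q t s k.
Proof.
case: t => [//|[|t]] _; first by rewrite (queue_init run).
by rewrite (queue_step run)// le_max lexx orbT.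
Qed.

Lemma drift_const_ge0 : 0 <= drift_const.
Proof.
by apply: addr_ge0; [apply: addr_ge0; [|apply: mulr_ge0]|apply: divr_ge0];
  rewrite ?sqr_ge0.
Qed.

Lemma round_drift y t s : X0 y -> (1 <= t)%N ->
  2^-1 * queue_norm t.+1 s ^+ 2 + T%:R * enorm (y - x t.+1 s) ^+ 2
    + Num.sqrt T%:R * (f t s (x t s) - f t s y) <=
  2^-1 * queue_norm t s ^+ 2 + T%:R * enorm (y - x t s) ^+ 2
    + queued_constraints y t s + drift_const.
Proof.
move=> Xy t1; have Xx := decision_in_domain s t1.
rewrite /drift_const (_ : D1 ^+ 2 / 4 =
  Num.sqrt T%:R ^+ 2 * D1 ^+ 2 / (4 * T%:R)); last first.
  by rewrite sqr_sqrtT; field; rewrite gt_eqF.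
apply: (@drift_plus_penalty _ _ _ X0 _ _ _ _ _ _ _ _ _ _ _ (gradf t s (x t s))
  _ _ (fun k => g k (x t s) (omega t s)) _ (fun k => gradg k (x t s) (omega t s))).
- exact: domain_convex domain.
- exact: sqrtr_ge0.
- exact: T_gt0R.
- exact: ltW.
- exact: (decision_step run s t1).
- by [].
- exact: (loss_subgradient losses s t1 Xx).
- exact: (loss_subgradient_le losses s t1 Xx).
- by move=> k; exact: (constraint_subgradient constraints k (omega t s) Xx).
- by move=> k; exact: (constraint_subgradient_le constraints).
- exact: (constraint_le constraints).
- by apply: (domain_diameter domain) => //; exact: decision_in_domain.
- by move=> k; exact: queue_ge0.
- by move=> k; rewrite (queue_step run)//.
Qed.

Lemma regret_le_queued_constraints y s : X0 y ->
  \sum_(1 <= t < T.+1) f t s (x t s) <=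
  \sum_(1 <= t < T.+1) f t s y + Num.sqrt T%:R * (Rad ^+ 2 + drift_const)
  + (Num.sqrt T%:R)^-1 * \sum_(1 <= t < T.+1) queued_constraints y t s.
Proof.
move=> Xy.
have telescope N : 2^-1 * queue_norm N.+1 s ^+ 2 + T%:R * enorm (y - x N.+1 s) ^+ 2
    + Num.sqrt T%:R * (\sum_(1 <= t < N.+1) (f t s (x t s) - f t s y)) <=
    T%:R * Rad ^+ 2 + \sum_(1 <= t < N.+1) queued_constraints y t s
    + N%:R * drift_const.
  elim: N => [|N IH].
    rewrite !big_geq// mulr0 mul0r !addr0 /queue_norm.
    rewrite (_ : \row_k _ = 0) => [|]; last first.
      by apply/rowP => k; rewrite !mxE (queue_init run).
    rewrite sqr_enorm /dot big1 => [|k _]; last by rewrite mxE mul0r.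
    rewrite mulr0 add0r ler_wpM2l// lerXn2r ?nnegrE ?enorm_ge0 ?(ltW Rad_gt0)//.
    by apply: (domain_diameter domain) => //; exact: decision_in_domain.
  have := round_drift s Xy (isT : (1 <= N.+1)%N).
  have -> : \sum_(1 <= t < N.+2) queued_constraints y t s =
    \sum_(1 <= t < N.+1) queued_constraints y t s + queued_constraints y N.+1 s.
    by rewrite big_nat_recr.
  rewrite (@big_nat_recr _ _ _ N.+1)//= -[N.+1%:R]natr1.
  by lra.
have := telescope T; rewrite sumrB.
set F := \sum_(_ <= _ < _) f _ s (x _ s); set Fy := \sum_(_ <= _ < _) f _ s y.
set Z := \sum_(_ <= _ < _) queued_constraints _ _ _.
have q0 : 0 <= 2^-1 * queue_norm T.+1 s ^+ 2 + T%:R * enorm (y - x T.+1 s) ^+ 2.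
  by apply: addr_ge0; apply: mulr_ge0; rewrite ?sqr_ge0.
move=> le; have {q0 le} : Num.sqrt T%:R * (F - Fy) <=
  Num.sqrt T%:R * (Num.sqrt T%:R * (Rad ^+ 2 + drift_const) + (Num.sqrt T%:R)^-1 * Z).
  rewrite [leRHS]mulrDr mulVKf; last by rewrite gt_eqF// (lt_le_trans ltr01).
  by rewrite mulrA -expr2 sqr_sqrtT mulrDr; lra.
by rewrite ler_pM2l ?(lt_le_trans ltr01)//; lra.
Qed.

Lemma queue_norm_le_potential y t s : queue_norm t s <= potential y t s.
Proof.
rewrite -[leLHS]ger0_norm ?enorm_ge0// -sqrtr_sqr ler_sqrt.
  by rewrite lerDl mulr_ge0 ?sqr_ge0 ?mulr_ge0//.
by apply: addr_ge0; rewrite ?sqr_ge0// mulr_ge0 ?sqr_ge0 ?mulr_ge0//.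
Qed.

Lemma sqr_potential y t s : potential y t s ^+ 2 =
  queue_norm t s ^+ 2 + 2 * T%:R * enorm (y - x t s) ^+ 2.
Proof.
rewrite sqr_sqrtr//; apply: addr_ge0; first exact: sqr_ge0.
by rewrite mulr_ge0 ?sqr_ge0 ?mulr_ge0//.
Qed.

Lemma potential_init y s : X0 y -> potential y 1 s <= 2 * Rad * Num.sqrt T%:R.
Proof.
move=> Xy; rewrite -[leRHS]ger0_norm ?mulr_ge0 ?sqrtr_ge0 ?(ltW Rad_gt0)//.
rewrite -sqrtr_sqr ler_sqrt ?sqr_ge0// /queue_norm.
rewrite (_ : \row_k _ = 0) => [|]; last first.
  by apply/rowP => k; rewrite !mxE (queue_init run).
rewrite sqr_enorm /dot big1 => [|k _]; last by rewrite mxE mul0r.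
rewrite add0r exprMn sqr_sqrtT [leRHS]mulrC [_ * T%:R]mulrC -mulrA ler_pM2l//.
have : enorm (y - x 1 s) ^+ 2 <= Rad ^+ 2.
  rewrite lerXn2r ?nnegrE ?enorm_ge0 ?(ltW Rad_gt0)//.
  by apply: (domain_diameter domain) => //; exact: decision_in_domain.
by have := sqr_ge0 Rad; rewrite exprMn; lra.
Qed.

(** The loss difference in [round_drift] has no sign; by the Lipschitz bound it
    costs at most [D1 * Rad] times [sqrt T]. *)
Lemma potential_drift y t s : X0 y -> (1 <= t)%N ->
  potential y t.+1 s ^+ 2 <= potential y t s ^+ 2
    + 2 * ((D1 * Rad + drift_const) * Num.sqrt T%:R + queued_constraints y t s).
Proof.
move=> Xy t1; have := round_drift s Xy t1; rewrite !sqr_potential.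
have Xx := decision_in_domain s t1.
have fyx : f t s y <= f t s (x t s) + D1 * Rad.
  apply: le_trans (subgradient_lipschitz Xx (loss_subgradient losses s t1 Xy)
    (loss_subgradient_le losses s t1 Xy)) _.
  by rewrite lerD2l ler_wpM2l ?(ltW D1_gt0)//; exact: (domain_diameter domain).
have : Num.sqrt T%:R * (f t s y - f t s (x t s)) <= Num.sqrt T%:R * (D1 * Rad).
  by rewrite ler_wpM2l ?sqrtr_ge0//; lra.
have : drift_const * 1 <= drift_const * Num.sqrt T%:R.
  by rewrite ler_wpM2l ?drift_const_ge0.

move: (queue_norm t.+1 s ^+ 2) (queue_norm t s ^+ 2) => a b.
move: (enorm _ ^+ 2) (enorm _ ^+ 2) (f t s y) (f t s (x t s)) => e e' fy fx.
move: (queued_constraints _ _ _) (Num.sqrt _) => q r.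
lra.
Qed.

(** The constants c, K, r and K' of the queue bound. [threshold] is at least
    1 and [2 * Rad], and [4 * slack_const <= eps * threshold]; [exp_rate]
    satisfies both smallness conditions of [expR_potential_le]. *)
Definition slack_const : R := D1 * Rad + drift_const.
Definition threshold : R := 1 + 2 * Rad + 4 * slack_const / eps.
Definition exp_rate : R := eps / (16 * G ^+ 2 + 2 * eps * G).
Definition queue_const : R := threshold + slack_const + G.

Lemma slack_const_ge0 : 0 <= slack_const.
Proof. by apply: addr_ge0 drift_const_ge0; apply: mulr_ge0; exact: ltW. Qed.

Lemma exp_rate_gt0 : 0 < exp_rate.
Proof. by rewrite divr_gt0// addr_gt0// !mulr_gt0// exprn_gt0. Qed.

Lemma threshold_gt0 : 0 < threshold.
Proof.
apply: ltr_pwDl; first by rewrite addr_gt0 ?mulr_gt0.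
by apply: divr_ge0; rewrite ?mulr_ge0 ?slack_const_ge0// ltW.
Qed.

Lemma queue_const_gt0 : 0 < queue_const.
Proof.
exact: addr_gt0 (ltr_wpDr slack_const_ge0 threshold_gt0) G_gt0.
Qed.

Lemma threshold_ge1 : 1 <= threshold.
Proof.
by rewrite /threshold -addrA lerDl addr_ge0 ?divr_ge0 ?mulr_ge0 ?slack_const_ge0// ltW.
Qed.

Lemma threshold_ge_diameter : 2 * Rad <= threshold.
Proof.
rewrite /threshold addrAC lerDr addr_ge0 ?divr_ge0 ?mulr_ge0 ?slack_const_ge0//.
exact: ltW.
Qed.

Lemma exp_rate_small : 16 * exp_rate * G ^+ 2 <= eps /\ 2 * exp_rate * G <= 1.
Proof.
have G2 : 0 < G ^+ 2 by rewrite exprn_gt0.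
have eG : 0 < eps * G by rewrite mulr_gt0.
have den : 0 < 16 * G ^+ 2 + 2 * eps * G by rewrite -mulrA; lra.
split.
  have -> : 16 * exp_rate * G ^+ 2 =
    eps * (16 * G ^+ 2) / (16 * G ^+ 2 + 2 * eps * G).
    by rewrite /exp_rate; field; rewrite gt_eqF.
  by rewrite ler_pdivrMr// ler_pM2l// -mulrA; lra.
have -> : 2 * exp_rate * G = 2 * eps * G / (16 * G ^+ 2 + 2 * eps * G).
  by rewrite /exp_rate; field; rewrite gt_eqF.
by rewrite ler_pdivrMr// mul1r -mulrA; lra.
Qed.


Lemma measurable_queue_norm t t' : (1 <= t <= t')%N ->
  measurable_fun (setT : set (g_sigma_algebraType (past omega t')))
    (queue_norm t).
Proof.
move=> /andP[t1 tt']; apply: measurable_enorm => k; under eq_fun do rewrite mxE.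
exact: measurable_wrt_history (queue_adapted adapted k t1) tt'.
Qed.

Lemma measurable_potential y t : (1 <= t)%N ->
  measurable_fun (setT : set (g_sigma_algebraType (past omega t))) (potential y t).
Proof.
move=> t1; apply: (measurableT_comp (continuous_measurable_fun (@sqrt_continuous R))).
apply: measurable_funD.
  by apply: measurable_funX; apply: measurable_queue_norm; rewrite t1 /=.
apply: measurable_funM => //; apply: measurable_funX; apply: measurable_enorm => i.
under eq_fun do rewrite !mxE; apply: measurable_funB => //.
exact: measurable_wrt_history (decision_adapted adapted i t1) _.
Qed.

Lemma queue_tail xhat t q : X0 xhat ->
  (forall k, 'E_mu[g k xhat] <= (- eps)%:E)%E -> (1 <= t)%N ->
  (P [set s | (q <= potential xhat t s)%R] <=
   (t%:R * expR (exp_rate * (queue_const * Num.sqrt T%:R - q)))%:E)%E.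
Proof.
move=> Xhat slater t1.
have r0 := exp_rate_gt0; have c0 := slack_const_ge0.
have k0 := threshold_gt0.
have mY j := measurable_potential xhat (t := j).
apply: le_trans (markov_expR q r0 (measurable_fun_sub_sigma
  (@past_measurable _ _ _ _ _ _ omega t) (mY _ t1))) _.
apply: (@le_trans _ _ ((expR (- (exp_rate * q)))%:E *
  (t%:R * expR (exp_rate * (queue_const * Num.sqrt T%:R)))%:E)%E); last first.
  rewrite -EFinM lee_fin mulrCA -expRD mulrBr addrC//.
rewrite lee_wpmul2l ?lee_fin ?expR_ge0//.
apply: (@expR_potential_le _ _ _ _ _ _ P mu (past omega)
  (fun t s => omega t s) _ _ _ (fun k => g k xhat) G G_gt0 _ _ Q
  _ eps (slack_const * Num.sqrt T%:R) (2 * T%:R * Rad ^+ 2)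
  (threshold * Num.sqrt T%:R)) => //.
- by move=> j _; exact: past_measurable.
- by move=> j A B' j1; exact: sample_fresh.
- by move=> k; exact: (constraint_measurable constraints).
- by move=> o; exact: (constraint_le constraints).
- by move=> j k j1; exact: measurable_wrt_history (queue_adapted adapted k j1) _.
- by move=> j s k; exact: queue_ge0.
- by move=> j s _; exact: queue_norm_le_potential.
- move=> j s j1; rewrite sqr_potential lerD2l ler_wpM2l ?mulr_ge0//.
  rewrite lerXn2r ?nnegrE ?enorm_ge0 ?(ltW Rad_gt0)//.
  by apply: (domain_diameter domain) => //; exact: decision_in_domain.
- by move=> j s j1; exact: potential_drift.
- by move=> k; have := slater k; rewrite unlock.
- by rewrite mulr_gt0// (lt_le_trans ltr01).
- by rewrite mulr_ge0 ?sqrtr_ge0.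
- rewrite !mulrA ler_wpM2r ?sqrtr_ge0//.
  have -> : eps * threshold = eps + 2 * eps * Rad + 4 * slack_const.
    by rewrite /threshold; field; rewrite gt_eqF.
  by rewrite lerDr addr_ge0 ?mulr_ge0// ltW.
- rewrite exprMn sqr_sqrtT.
  have -> : 2 * (2 * T%:R * Rad ^+ 2) = (2 * Rad) ^+ 2 * T%:R by ring.
  rewrite ler_pM2r// lerXn2r ?nnegrE ?mulr_ge0 ?(ltW k0) ?(ltW Rad_gt0)//.
  exact: threshold_ge_diameter.
- by rewrite mulr_ge0 ?sqrtr_ge0// (ltW queue_const_gt0).
- rewrite !exprMn sqr_sqrtT.
  have sT : Num.sqrt T%:R <= T%:R :> R.
    by rewrite -[leRHS]sqr_sqrtT expr2 ler_peMr ?sqrtr_ge0.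
  have k1 := threshold_ge1.
  apply: (@le_trans _ _ (threshold ^+ 2 * T%:R +
      2 * threshold * (slack_const + G) * T%:R)).
    rewrite lerD2l mulrAC -mulrDl mulrA.
    apply: ler_pM (sqrtr_ge0 _) _ sT.
      by rewrite mulr_ge0// addr_ge0// mulr_ge0// ltW.
    by rewrite -mulrA ler_pM2l// mulrDr lerD2r ler_peMl.
  rewrite -mulrDl ler_pM2r//.
  have -> : queue_const ^+ 2 = threshold ^+ 2 + 2 * threshold * (slack_const + G)
    + (slack_const + G) ^+ 2 by rewrite /queue_const; ring.
  by rewrite lerDl sqr_ge0.
- move=> s; apply: le_trans (potential_init _ Xhat) _.
  rewrite ler_wpM2r ?sqrtr_ge0//; apply: le_trans threshold_ge_diameter _.
  by rewrite /queue_const -addrA lerDl addr_ge0// ltW.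
- by have [] := exp_rate_small.
- by have [] := exp_rate_small.
Qed.
Definition regret_const : R :=
  Rad ^+ 2 + drift_const + 4 * G * (queue_const + 4 / exp_rate).

Lemma measurable_loss_at_decision t : (1 <= t)%N ->
  measurable_fun setT (fun s => f t s (x t s)).
Proof.
move=> t1; apply: (measurable_fun_lipschitz (A := X0) D1_gt0).
- by move=> z Xz; exact: (loss_measurable losses).
- move=> s y z Xy Xz; apply: subgradient_lipschitz Xz _ _.
    exact: (loss_subgradient losses).
  exact: (loss_subgradient_le losses).
- by move=> s; exact: decision_in_domain.
- move=> i; apply: (measurable_fun_sub_sigma (@past_measurable _ _ _ _ _ _ omega t)).
  exact: measurable_wrt_history (decision_adapted adapted i t1) _.
Qed.

Lemma measurable_sum_from1 (F : nat -> S -> R) :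
  (forall t, (1 <= t)%N -> measurable_fun setT (F t)) ->
  measurable_fun setT (fun s => \sum_(1 <= t < T.+1) F t s).
Proof.
move=> mF; under eq_fun do rewrite big_add1 big_mkord.
by apply: measurable_sum => t; exact: mF.
Qed.

(** The failure probability is shared equally by the two kinds of bad events:
    [lambda / (2 * T)] for each of the [T] rounds in which the potential could
    exceed [q], and [lambda / 2] for a large truncated sum. *)
Lemma regret_high_probability xhat xstar lambda :
  X0 xhat -> (forall k, 'E_mu[g k xhat] <= (- eps)%:E)%E ->
  X0 xstar -> (forall k, 'E_mu[g k xstar] <= 0)%E -> 0 < lambda < 1 ->
  ((1 - lambda)%:E <=
   P [set s | (\sum_(1 <= t < T.+1) f t s (x t s) <=
              \sum_(1 <= t < T.+1) f t s xstar
              + regret_const * (Num.sqrt T%:R * Num.max 1 (ln T%:R)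
                     * Num.max 1 (ln lambda^-1) `^ (3 / 2)))%R])%E.
Proof.
move=> Xhat slater Xstar feasible /andP[l0 l1].
have r0 := exp_rate_gt0; have k0 := queue_const_gt0.
have sT0 : 0 < Num.sqrt T%:R :> R by exact: lt_le_trans sqrtT_ge1.
pose MT : R := Num.max 1 (ln T%:R).
pose ML : R := Num.max 1 (ln lambda^-1).
have MT1 : 1 <= MT by rewrite le_max lexx.
have ML1 : 1 <= ML by rewrite le_max lexx.
have lnl0 : 0 < ln lambda^-1 by rewrite ln_gt0// invf_gt1.
have ln2_0 : 0 < ln 2 :> R by rewrite ln_gt0// ltr1n.
have lnT0 : 0 <= ln T%:R :> R by rewrite ln_ge0// ler1n.
pose l : R := ln 2 + ln lambda^-1.
have lgt0 : 0 < l by rewrite addr_gt0.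
pose e : R := ln 2 + 2 * ln T%:R + ln lambda^-1.
have egt0 : 0 < e by rewrite addr_gt0// ltr_pwDl// mulr_ge0.
pose q := queue_const * Num.sqrt T%:R + exp_rate^-1 * e.
have q0 : 0 < q by rewrite addr_gt0 ?mulr_gt0 ?invr_gt0.
have qG0 : 0 < q * G by rewrite mulr_gt0.
(* theta minimizes - theta * z + 2 * T * (theta * q * G) ^+ 2, and z is such
   that the minimum is - l = - ln (2 / lambda). *)
pose z := q * G * Num.sqrt (8 * T%:R * l).
pose theta := Num.sqrt (l / (2 * T%:R)) / (q * G).
have theta0 : 0 < theta by rewrite divr_gt0// sqrtr_gt0 divr_gt0// mulr_gt0.
pose a t s k := if queue_norm t s <= q then Q t s k else 0.
pose Z s := \sum_(1 <= t < T.+1) \sum_k a t s k * g k xstar (omega t s).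
have a_past t t' k : (1 <= t <= t')%N ->
    measurable_fun (setT : set (g_sigma_algebraType (past omega t')))
      (fun s => a t s k).
  move=> /andP[t1 tt']; apply: measurable_fun_ifT => //.
    by apply: measurable_fun_ler => //; apply: measurable_queue_norm; rewrite t1.
  exact: measurable_wrt_history (queue_adapted adapted k t1) tt'.
have mZ : measurable_fun setT Z.
  apply: measurable_sum_from1 => t t1; apply: measurable_sum => k.
  apply: measurable_funM.
    apply: (measurable_fun_sub_sigma (@past_measurable _ _ _ _ _ _ omega t)).
    by apply: a_past; rewrite t1 /=.
  apply: measurableT_comp => //; exact: (constraint_measurable constraints).
have mg k : measurable_fun setT (g k xstar).
  exact: (constraint_measurable constraints).
have PZ : (P [set s | (z <= Z s)%R] <= (lambda / 2)%:E)%E.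
  apply: le_trans (markov_expR z theta0 mZ) _.
  apply: (@le_trans _ _ ((expR (- (theta * z)))%:E *
      (expR (T%:R * (2 * (theta * (q * G)) ^+ 2)))%:E)%E).
    rewrite lee_wpmul2l ?lee_fin ?expR_ge0//.
    apply: (@expR_weighted_sum_le _ _ _ _ _ _ P mu (past omega)
      (fun t s => omega t s) _ _ _ (fun k => g k xstar) G) => //.
    - by move=> t _; exact: past_measurable.
    - by move=> t A B' t1; exact: sample_fresh.
    - by move=> o; exact: (constraint_le constraints).
    - by move=> t t'; exact: sample_past_measurable.
    - by move=> t s k t1; rewrite /a; case: ifP => // _; exact: queue_ge0.
    - move=> t s t1; rewrite ler_pM2r// /a; case: (boolP (queue_norm t s <= q)) => // _.
      rewrite (_ : \row_(k < m) 0 = 0 :> 'rV[R]_m).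
        by rewrite /enorm /dot big1 ?sqrtr0 ?ltW// => k _; rewrite mxE mul0r.
      by apply/rowP => k; rewrite !mxE.
    - by move=> k; have := feasible k; rewrite unlock.
    - exact: ltW.
  rewrite -EFinM -expRD lee_fin.
  have thz : theta * z = 2 * l.
    rewrite /theta /z mulrA divfK ?gt_eqF// -sqrtrM; last first.
      by rewrite divr_ge0 ?mulr_ge0 ?ltW.
    have -> : l / (2 * T%:R) * (8 * T%:R * l) = (2 * l) ^+ 2.
      by field; rewrite gt_eqF.
    by rewrite sqrtr_sqr ger0_norm// mulr_ge0// ltW.
  have th2 : T%:R * (2 * (theta * (q * G)) ^+ 2) = l.
    rewrite /theta divfK ?gt_eqF// sqr_sqrtr; last by rewrite divr_ge0 ?mulr_ge0 ?ltW.
    by field; rewrite gt_eqF.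
  rewrite thz th2 (_ : - (2 * l) + l = - l); last by ring.
  by rewrite expRN expRD !lnK ?posrE ?invr_gt0// invfM invrK mulrC.
have PQ i : (i < T)%N -> (P [set s | (q <= potential xhat i.+1 s)%R] <=
    (lambda / (2 * T%:R))%:E)%E.
  move=> iT; apply: le_trans (queue_tail q Xhat slater (isT : (1 <= i.+1)%N)) _.
  rewrite lee_fin.
  have -> : exp_rate * (queue_const * Num.sqrt T%:R - q) = - e.
    by rewrite /q opprD addNKr mulrN mulVKf// gt_eqF.
  have -> : expR (- e) = (2 * T%:R ^+ 2 * lambda^-1)^-1.
    by rewrite expRN /e !expRD expRM_natl !lnK ?posrE ?invr_gt0.
  have -> : lambda / (2 * T%:R) = T%:R * (2 * T%:R ^+ 2 * lambda^-1)^-1.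
    by field; rewrite !gt_eqF.
  rewrite ler_wpM2r ?ler_nat// invr_ge0 !mulr_ge0 ?sqr_ge0// invr_ge0.
  exact: ltW.
set A := [set s | _].
have mA : measurable A.
  rewrite -[A]setTI; apply: (measurable_fun_ler _ _ measurableT) => //.
    exact: measurable_sum_from1 measurable_loss_at_decision.
  apply: measurable_funD => //; apply: measurable_sum_from1 => t t1.
  exact: (loss_measurable losses).
have mpot i : measurable [set s | q <= potential xhat i.+1 s].
  rewrite -[X in measurable X]setTI; apply: (measurable_fun_ler _ _ measurableT) => //.
  apply: (measurable_fun_sub_sigma (@past_measurable _ _ _ _ _ _ omega i.+1)).
  exact: measurable_potential.
have mZz : measurable [set s | z <= Z s].
  by rewrite -[X in measurable X]setTI; apply: (measurable_fun_ler _ _ measurableT).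
have bad : ~` A `<=` \big[setU/set0]_(i < T) [set s | q <= potential xhat i.+1 s]
    `|` [set s | z <= Z s].
  move=> s; apply: contra_notP => /not_orP[noQ /negP]; rewrite -ltNge => Zz.
  rewrite /A /=; apply: le_trans (regret_le_queued_constraints s Xstar) _.
  rewrite -addrA lerD2l.
  have -> : \sum_(1 <= t < T.+1) queued_constraints xstar t s = Z s.
    rewrite /Z big_nat [RHS]big_nat; apply: eq_bigr => t /andP[t1 tT].
    apply: eq_bigr => k _; rewrite /a ifT//.
    apply: le_trans (queue_norm_le_potential xhat t s) _.
    rewrite leNgt; apply/negP => /ltW qt; apply: noQ.
    rewrite -(bigcup_mkord T (fun i => [set s | q <= potential xhat i.+1 s])).
    exists t.-1; first by rewrite /= prednK.
    by rewrite /= prednK.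
  apply: (@le_trans _ _ (Num.sqrt T%:R * (Rad ^+ 2 + drift_const)
     + q * G * Num.sqrt (8 * l))).
    rewrite lerD2l ler_pdivrMl// (le_trans (ltW Zz))// /z.
    have -> : 8 * T%:R * l = T%:R * (8 * l) by ring.
    by rewrite sqrtrM ?ler0n// mulrCA.
  have ML0 : 0 < ML by exact: lt_le_trans ML1.
  have -> : Num.max 1 (ln lambda^-1) `^ (3 / 2) = ML * Num.sqrt ML.
    rewrite -/ML -powR12_sqrt ?ltW// -{2}[ML]powRr1 ?ltW// -powRD.
      by congr (_ `^ _); lra.
    by rewrite (gt_eqF ML0) implybT.
  have MTln : ln T%:R <= MT by rewrite le_max lexx orbT.
  have MLln : ln lambda^-1 <= ML by rewrite le_max lexx orbT.
  have ln2 := @ln2_le1 R.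
  rewrite /regret_const; apply: regret_constant_le => //.
  - by rewrite addr_ge0 ?sqr_ge0 ?drift_const_ge0.
  - exact: ltW.
  - exact: ltW.
  - exact: ltW.
  - by rewrite /l; lra.
  - rewrite lerD2l ler_pM2l ?invr_gt0//.
    by apply: lerD MLln; apply: lerD => //; rewrite ler_pM2l.
have PA : (P (~` A) <= lambda%:E)%E.
  apply: (@le_trans _ _ (P (\big[setU/set0]_(i < T)
    [set s | (q <= potential xhat i.+1 s)%R] `|` [set s | (z <= Z s)%R]))).
    apply: le_measure => //; rewrite ?inE; first exact: measurableC.
    by apply: measurableU => //; exact: bigsetU_measurable.
  apply: le_trans (measureU2 _ _ _) _ => //; first exact: bigsetU_measurable.
  have -> : lambda%:E = (\sum_(i < T) (lambda / (2 * T%:R))%:E + (lambda / 2)%:E)%E.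
    rewrite sumEFin sumr_const card_ord -EFinD -[_ *+ T]mulr_natr; congr _%:E.
    by field; rewrite gt_eqF.
  apply: leeD => //; apply: le_trans (@Boole_inequality _ _ _ P
    (fun i => [set s | q <= potential xhat i.+1 s]) T (fun i _ => mpot i)) _.
  by apply: lee_sum => i _; exact: PQ.
rewrite -[A]setCK probability_setC; last exact: measurableC.
by rewrite EFinB leeB.
Qed.

End run.

Theorem theorem4 (R : realType) (n m : nat) (D1 D2 G Rad eps : R)
    (D1_gt0 : 0 < D1) (D2_gt0 : 0 < D2) (G_gt0 : 0 < G) (Rad_gt0 : 0 < Rad)
    (eps_gt0 : 0 < eps) :
  exists C : R,
  forall (X0 : set 'rV[R]_n)
    (dO : measure_display) (Omega : measurableType dO)
    (mu : probability Omega R)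
    (g : 'I_m -> 'rV[R]_n -> Omega -> R)
    (gradg : 'I_m -> 'rV[R]_n -> Omega -> 'rV[R]_n)
    (d : measure_display) (S : measurableType d) (P : probability S R)
    (omega : nat -> {RV P >-> Omega})
    (xstar : 'rV[R]_n),
  bounded_domain X0 Rad ->
  constraint_functions X0 g gradg D2 G ->
  slater X0 mu g eps ->
  iid_samples mu omega ->
  X0 xstar ->
  (forall k, ('E_mu[g k xstar] <= 0)%E) ->
  forall (T : nat) (lambda : R)
    (f : nat -> S -> 'rV[R]_n -> R)
    (gradf : nat -> S -> 'rV[R]_n -> 'rV[R]_n)
    (x : nat -> S -> 'rV[R]_n) (Q : nat -> S -> 'I_m -> R),
  (1 <= T)%N -> 0 < lambda < 1 ->
  loss_functions X0 omega f gradf D1 ->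
  algorithm1 X0 g gradg omega gradf (Num.sqrt T%:R) T%:R x Q ->
  adapted_run omega x Q ->
  ((1 - lambda)%:E <=
   P [set s | (\sum_(1 <= t < T.+1) f t s (x t s) <=
              \sum_(1 <= t < T.+1) f t s xstar
              + C * (Num.sqrt T%:R * Num.max 1 (ln T%:R)
                     * Num.max 1 (ln lambda^-1) `^ (3 / 2)))%R])%E.
Proof.
exists (@regret_const R m D1 D2 G Rad eps).
move=> X0 dO Omega mu g gradg d S P omega xstar domain constraints.
move=> [xhat Xhat slater] iid Xstar feasible T lambda f gradf x Q T1 l01.
move=> losses run adapted.
exact: (regret_high_probability D1_gt0 G_gt0 Rad_gt0 eps_gt0 domain constraints
  T1 losses iid adapted run Xhat slater Xstar feasible l01).
Qed.
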